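(* Let $g\geq 2$. The spaces $M_g^{\rm trop}[3]$ and ${\rm Sch}_g^{\rm trop}$ have pure dimension $3g-3$ and are connected through codimension one. The same holds for $M_g^{\rm pure}[3]$ and ${\rm Sch}_g^{\rm pure}$.
   Context: A weighted graph is a pair $(\Gamma,w)$, $\Gamma$ a finite connected graph (no legs), $w:V(\Gamma)\to\mathbb{Z}_{\geq0}$; genus $g=b_1(\Gamma)+\sum_v w(v)$; stable if every weight-0 vertex has valency $\geq 3$. Weighted contraction of $S\subset E(\Gamma)$: contract the edges of $S$, giving each new vertex the weight $b_1$ of its preimage plus the sum of the weights in the preimage. $M(\Gamma,w)=(\mathbb{R}_{>0})^{E(\Gamma)}/\mathrm{Aut}(\Gamma,w)$ is a connected orbifold of dimension $|E(\Gamma)|$; $M_g^{\rm trop}=\coprod M(\Gamma,w)$ over stable genus-$g$ weighted graphs, topologized so that each stratum embeds homeomorphically and $M(\Gamma',w')\subset\overline{M(\Gamma,w)}$ iff $(\Gamma',w')$ is a weighted contraction of $(\Gamma,w)$. $M_g^{\rm pure}$ is the union of strata with $w\equiv 0$. A graph is 3-edge-connected if it has a vertex and stays connected after deleting any fewer than 3 edges; $M_g^{\rm trop}[3]$ (resp. $M_g^{\rm pure}[3]$) is the union of the strata $M(\Gamma,w)$ of $M_g^{\rm trop}$ (resp. $M_g^{\rm pure}$) with $\Gamma$ 3-edge-connected. The tropical Torelli map $t_g^{\rm trop}:M_g^{\rm trop}\to A_g^{\rm trop}$ sends a tropical curve to its tropical Jacobian; ${\rm Sch}_g^{\rm trop}$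 is its image, identified with the quotient topological space $M_g^{\rm trop}/\!\equiv$ where two curves are equivalent iff they have the same image (similarly ${\rm Sch}_g^{\rm pure}$ from $M_g^{\rm pure}$). Known background facts: $t_g^{\rm trop}(M_g^{\rm trop}[3])={\rm Sch}_g^{\rm trop}$, the restriction of $t_g^{\rm trop}$ to $M_g^{\rm trop}[3]$ has finite fibers and is injective (a homeomorphism onto its image) on each stratum $M(\Gamma,w)$, and ${\rm Sch}_g^{\rm trop}$ is decomposed into the images of these strata; analogously for the pure versions. A space $X$ of pure dimension $d$ with a decomposition into connected orbifolds $X_i$ is connected through codimension one if $\coprod_{\dim X_i\geq d-1}X_i$ is connected. *)

(* Defs.v *)
From mathcomp Require Import all_boot all_order all_algebra.
From mathcomp Require Import reals.
Set Implicit Arguments. Unset Strict Implicit. Unset Printing Implicit Defensive.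
Import Order.TTheory GRing.Theory Num.Theory.
Local Open Scope ring_scope.

(* Vertices 'I_nv, edges 'I_ne; each edge has an (arbitrary) orientation *)
(* (tail, head) = ends e; orientation is irrelevant up to isomorphism.  *)
Record wgraph := WGraph {
  nv : nat;
  ne : nat;
  ends : 'I_ne -> 'I_nv * 'I_nv;
  wt : 'I_nv -> nat }.

Definition adj_wo (G : wgraph) (S : {set 'I_(ne G)}) : rel 'I_(nv G) :=
  fun u v => [exists e : 'I_(ne G),
     (e \notin S) && ((ends e == (u, v)) || (ends e == (v, u)))].

Definition connected_wo (G : wgraph) (S : {set 'I_(ne G)}) : Prop :=
  (0 < nv G)%N /\ forall u v : 'I_(nv G), connect (adj_wo S) u v.

Definition connected_graph (G : wgraph) : Prop := connected_wo (G := G) set0.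

Definition three_edge_connected (G : wgraph) : Prop :=
  (0 < nv G)%N /\ forall S : {set 'I_(ne G)}, (#|S| < 3)%N -> connected_wo S.

Definition valency (G : wgraph) (v : 'I_(nv G)) : nat :=
  (#|[set e : 'I_(ne G) | (ends e).1 == v]| + #|[set e : 'I_(ne G) | (ends e).2 == v]|)%N.

(* genus = b_1 + sum of weights  (b_1 = |E| - |V| + 1 for a connected graph) *)
Definition genus (G : wgraph) : nat :=
  ((ne G + 1 - nv G) + \sum_(v < nv G) wt v)%N.

Definition stable (G : wgraph) : Prop :=
  forall v : 'I_(nv G), wt v = 0%N -> (3 <= valency v)%N.

Definition wg_ok (pure : bool) (g : nat) (G : wgraph) : Prop :=
  [/\ connected_graph G, stable G, genus G = g &
      (if pure then forall v : 'I_(nv G), wt v = 0%N else True)].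

Definition wg_iso (G G' : wgraph) : Prop :=
  exists (s : 'I_(nv G) -> 'I_(nv G')) (t : 'I_(ne G) -> 'I_(ne G')),
    [/\ bijective s, bijective t,
        forall e, ends (t e) = (s (ends e).1, s (ends e).2) \/
                  ends (t e) = (s (ends e).2, s (ends e).1) &
        forall v, wt (s v) = wt v].

Section Curves.
Variable R : realType.

Record tcurve := TCurve { cg : wgraph; len : 'I_(ne cg) -> R }.

Definition curve_iso (C C' : tcurve) : Prop :=
  exists (s : 'I_(nv (cg C)) -> 'I_(nv (cg C'))) (t : 'I_(ne (cg C)) -> 'I_(ne (cg C'))),
    [/\ bijective s, bijective t,
        forall e, ends (t e) = (s (ends e).1, s (ends e).2) \/
                  ends (t e) = (s (ends e).2, s (ends e).1),
        forall v, wt (s v) = wt v &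
        forall e, len (t e) = len e].

(* Points of M_g^trop (resp. M_g^pure): stable genus-g curves with positive
   lengths (considered up to [curve_iso]). *)
Definition isM (pure : bool) (g : nat) (C : tcurve) : Prop :=
  wg_ok pure g (cg C) /\ forall e : 'I_(ne (cg C)), 0 < len e.

Definition isM3 (pure : bool) (g : nat) (C : tcurve) : Prop :=
  isM pure g C /\ three_edge_connected (cg C).

Definition stratum (G : wgraph) (C : tcurve) : Prop :=
  wg_iso G (cg C) /\ forall e : 'I_(ne (cg C)), 0 < len e.

(* [contr G l C']: C' is the tropical curve obtained from G with lengths
   l >= 0 by the weighted contraction of the set Z of zero-length edges.
   pi : V(G) -> V(C') collapses exactly the connected components of (V, Z);
   iota : E(C') -> E(G) is a bijection onto E(G) \ Z compatible with ends;
   new weight of a vertex = b_1 of its preimage + sum of weights there. *)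
Definition contr (G : wgraph) (l : 'I_(ne G) -> R) (C' : tcurve) : Prop :=
  let Z := [set e : 'I_(ne G) | l e == 0] in
  exists (pi : 'I_(nv G) -> 'I_(nv (cg C'))) (iota : 'I_(ne (cg C')) -> 'I_(ne G)),
   (forall v', exists v, pi v = v') /\
      (
       injective iota) /\
      (
       forall e, e \notin Z <-> exists e', iota e' = e) /\
      (
       forall u v, pi u = pi v <-> connect (adj_wo (~: Z)) u v) /\
      (
       forall e', ends e' = (pi (ends (iota e')).1, pi (ends (iota e')).2)) /\
      (
       forall v', wt v' =
          ((#|[set e in Z | pi (ends e).1 == v']| + 1
             - #|[set v | pi v == v']|)
           + \sum_(v < nv G | pi v == v') wt v)%N) /\
      (
       forall e', len e' = l (iota e')).

(* Open subsets of M_g (pure or not): iso-invariant sets whose preimage in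
   every closed cone R_{>=0}^{E(G)} (G stable of genus g) is open.  This is
   the colimit (quotient) topology of the generalized cone complex. *)
Definition Mopen (pure : bool) (g : nat) (U : tcurve -> Prop) : Prop :=
  (forall C C', isM pure g C -> isM pure g C' -> curve_iso C C' -> U C -> U C') /\
  forall G, wg_ok pure g G ->
  forall l : 'I_(ne G) -> R, (forall e, 0 <= l e) ->
    (exists C', contr l C' /\ U C') ->
    exists2 eps : R, 0 < eps &
      forall l' : 'I_(ne G) -> R, (forall e, 0 <= l' e) ->
        (forall e, `|l' e - l e| < eps) -> exists C', contr l' C' /\ U C'.

(* Quotient-of-subspace topology: X is a subset of M_g^trop, eqv an
   equivalence; open sets of X/eqv correspond to eqv-saturated (in X) sets
   which are traces on X of open sets of M_g^trop. *)
Definition qopen (g : nat) (X : tcurve -> Prop) (eqv : tcurve -> tcurve -> Prop)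
    (O : tcurve -> Prop) : Prop :=
  [/\ forall C, O C -> X C,
      forall C C', X C -> X C' -> eqv C C' -> O C -> O C' &
      exists U, Mopen false g U /\ forall C, X C -> (O C <-> U C)].

(* S (an eqv-saturated subset of X) is connected in X/eqv *)
Definition qconnected g X eqv (S : tcurve -> Prop) : Prop :=
  ~ exists O1 O2, [/\ qopen g X eqv O1, qopen g X eqv O2,
       forall C, S C -> O1 C \/ O2 C,
       forall C, S C -> O1 C -> O2 C -> False &
       (exists C, S C /\ O1 C) /\ (exists C, S C /\ O2 C)].

Definition in_qclosure g X eqv (A : tcurve -> Prop) (C : tcurve) : Prop :=
  forall O, qopen g X eqv O -> O C -> exists C', A C' /\ O C'.

(* Tropical Torelli map: the tropical Jacobian of C is the class, modulo *)
(* GL_g(Z), of the quadratic form Q_C on H_1(G,Z) (+) Z^{|w|}           *)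
(* (Q_C(z,a) = sum_e l(e) z_e^2, zero on the weight part).  Two curves   *)
(* have the same image iff these rank-g lattices with forms are         *)
(* isometric.                                                           *)
Definition totw (G : wgraph) : nat := (\sum_(v < nv G) wt v)%N.

Definition amb (C : tcurve) : Type :=
  ({ffun 'I_(ne (cg C)) -> int} * {ffun 'I_(totw (cg C)) -> int})%type.

Definition is_cycle (G : wgraph) (z : {ffun 'I_(ne G) -> int}) : Prop :=
  forall v : 'I_(nv G),
    \sum_(e < ne G | (ends e).2 == v) z e - \sum_(e < ne G | (ends e).1 == v) z e = 0.

Definition lat (C : tcurve) (x : amb C) : Prop := is_cycle x.1.

Definition Qform (C : tcurve) (x : amb C) : R :=
  \sum_(e < ne (cg C)) len e * ((x.1 e) ^+ 2)%:~R.

Definition torelli_eq (C C' : tcurve) : Prop :=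
  exists phi : amb C -> amb C',
  [/\ forall x, lat x -> lat (phi x),
      forall x y, lat x -> lat y -> phi (x + y) = phi x + phi y,
      forall x y, lat x -> lat y -> phi x = phi y -> x = y,
      forall y, lat y -> exists x, lat x /\ phi x = y &
      forall x, lat x -> Qform (phi x) = Qform x].

Definition wg3_ok pure g G := wg_ok pure g G /\ three_edge_connected G.

(* M_g^{trop/pure}[3], decomposed into the strata M(G), dim M(G) = |E(G)|:
   pure dimension d *)
Definition M3_pure_dim (pure : bool) (g d : nat) : Prop :=
  forall G, wg3_ok pure g G ->
    (ne G <= d)%N /\
    exists G', [/\ wg3_ok pure g G', ne G' = d &
      forall C, stratum G C -> in_qclosure g (isM3 pure g) curve_iso (stratum G') C].

Definition M3_conn_codim1 (pure : bool) (g d : nat) : Prop :=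
  qconnected g (isM3 pure g) curve_iso
    (fun C => isM3 pure g C /\ (d - 1 <= ne (cg C))%N).

(* Sch_g^{trop/pure} = M_g^{trop/pure} / torelli_eq, decomposed into the
   images of the strata M(G) of M_g^{trop/pure}[3]; the image of M(G) is
   homeomorphic to M(G), hence has dimension |E(G)|. *)
Definition image_stratum (pure : bool) (g : nat) (G : wgraph) (C : tcurve) : Prop :=
  isM pure g C /\ exists C', stratum G C' /\ torelli_eq C C'.

Definition Sch_pure_dim (pure : bool) (g d : nat) : Prop :=
  forall G, wg3_ok pure g G ->
    (ne G <= d)%N /\
    exists G', [/\ wg3_ok pure g G', ne G' = d &
      forall C, image_stratum pure g G C ->
        in_qclosure g (isM pure g) torelli_eq (image_stratum pure g G') C].

Definition Sch_conn_codim1 (pure : bool) (g d : nat) : Prop :=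
  qconnected g (isM pure g) torelli_eq
    (fun C => isM pure g C /\
       exists C', [/\ isM3 pure g C', (d - 1 <= ne (cg C'))%N & torelli_eq C C']).

End Curves.

(* Main.v *)
Require Import Defs.
From mathcomp Require Import all_boot all_order all_algebra.
From mathcomp Require Import reals.
From mathcomp Require Import zify lra.
Set Implicit Arguments. Unset Strict Implicit. Unset Printing Implicit Defensive.
Import Order.TTheory GRing.Theory Num.Theory.

(** Codimension-one connectedness reduces to a statement on graphs. A stratum is a connected
    quotient of an open cone and lies in the closure of the stratum of every graph that
    contracts onto it, so in a separation each stratum lies on one side, and strata of
    codimension 0 and 1 related by the contraction of one edge lie on the same side. It
    remains to see that

    - a 3-edge-connected graph of genus [g] that is not cubic and weightless is the contraction
      of one edge of a 3-edge-connected graph of genus [g]: trade a weight for a loop, or split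
      off two edge ends at a vertex of valency at least 4, chosen by uncrossing the 3-edge cuts;
    - any two 3-edge-connected cubic graphs of genus [g] are related by Whitehead moves inside
      this class. By induction on [g]: such a graph with more than two vertices arises from a
      smaller one by subdividing two distinct edges and joining the two new vertices by an edge.
      The ends of that edge can be slid freely along the smaller graph, which stays connected
      without any one edge, and a Whitehead move of the smaller graph lifts once they are slid
      off the edge being moved.

    For the Schottky locus, open sets of the quotient restrict to open sets of [isM3], and
    every point that is needed has a representative there. *)

(** * Edge cuts *)

(** Vertices and edges range over arbitrary finite types, so that constructions can use [option],
    sums and subtypes. An edge has an end for each boolean; the pairs of an edge and a boolean are
    the darts, and a loop has two of them. *)
Record fgraph := FGraph {
  fV : finType;
  fE : finType;
  att : fE -> bool -> fV;
  fw : fV -> nat }.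

Definition bnd (G : fgraph) (A : {set fV G}) : {set fE G} :=
  [set e | (att e false \in A) != (att e true \in A)].

Definition inn (G : fgraph) (A : {set fV G}) : {set fE G} :=
  [set e | (att e false \in A) && (att e true \in A)].

Definition darts (G : fgraph) (A : {set fV G}) : {set fE G * bool} :=
  [set d | att d.1 d.2 \in A].

Definition deg (G : fgraph) (v : fV G) : nat := #|darts [set v]|.

(** Edge connectivity in terms of cuts: deleting fewer than [k] edges cannot exhaust a cut. A
    one-vertex graph has no cut to check. *)
Definition kconn (k : nat) (G : fgraph) : Prop :=
  0 < #|fV G| /\
  forall A : {set fV G}, A != set0 -> A != setT -> k <= #|bnd A|.

Definition fgenus (G : fgraph) : nat :=
  #|fE G| + 1 - #|fV G| + \sum_(v : fV G) fw v.

Definition weightless (G : fgraph) : Prop := forall v : fV G, fw v = 0.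

Definition fok (pure : bool) (g : nat) (G : fgraph) : Prop :=
  [/\ kconn 3 G, fgenus G = g & pure -> weightless G].

(* Summing the degrees, which are at least 3, shows that such a graph is cubic ([top_deg]). *)
Definition top (G : fgraph) : Prop :=
  [/\ kconn 3 G, weightless G & 2 * #|fE G| = 3 * #|fV G|].

Section Counting.
Variable G : fgraph.
Implicit Types A B : {set fV G}.

Lemma cards_sum (T : finType) (P : pred T) : #|[set x | P x]| = \sum_x (P x : nat).
Proof. by rewrite cardsE -sum1_card big_mkcond; apply: eq_bigr => x _; rewrite unfold_in; case: (P x). Qed.

Lemma card_darts A : #|darts A| = 2 * #|inn A| + #|bnd A|.
Proof.
rewrite !cards_sum big_distrr -big_split /=.
rewrite (eq_bigr (fun e => \sum_(b : bool) (att e b \in A : nat))).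
  by rewrite pair_big; apply: eq_bigr.
by move=> e _; rewrite big_bool; case: (_ \in A); case: (_ \in A).
Qed.

Lemma sum_deg A : \sum_(v in A) deg v = #|darts A|.
Proof.
rewrite cards_sum (eq_bigr (fun v => \sum_(d : fE G * bool) (att d.1 d.2 == v : nat))).
  rewrite exchange_big; apply: eq_bigr => d _ /=.
  have [dA|dA] := boolP (_ \in A).
    rewrite (bigD1 _ dA) /= eqxx big1 // => v /andP[_].
    by rewrite eq_sym => /negPf->.
  by apply: big1 => v vA; case: eqP => // E; rewrite E vA in dA.
by move=> v _; rewrite /deg cards_sum; apply: eq_bigr => d _; rewrite inE.
Qed.

Lemma bndC A : bnd (~: A) = bnd A.
Proof. by apply/setP => e; rewrite !inE; case: (_ \in A); case: (_ \in A). Qed.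

(** Submodularity of the cut function, checked edge by edge on the positions of the two ends. The
    version with differences follows in the same way; together they uncross two cuts. *)
Lemma bnd_submod A B : #|bnd (A :&: B)| + #|bnd (A :|: B)| <= #|bnd A| + #|bnd B|.
Proof.
rewrite !cards_sum -!big_split /=; apply: leq_sum => e _; rewrite !inE.
by case: (_ \in A); case: (_ \in A); case: (_ \in B); case: (_ \in B).
Qed.

Lemma bnd_submodD A B : #|bnd (A :\: B)| + #|bnd (B :\: A)| <= #|bnd A| + #|bnd B|.
Proof.
rewrite !cards_sum -!big_split /=; apply: leq_sum => e _; rewrite !inE.
by case: (_ \in A); case: (_ \in A); case: (_ \in B); case: (_ \in B).
Qed.

Lemma dartsT : #|darts [set: fV G]| = 2 * #|fE G|.
Proof.
rewrite card_darts (_ : inn _ = setT) ?cardsT; last by apply/setP=> e; rewrite !inE.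
by rewrite (_ : bnd _ = set0) ?cards0 ?addn0 //; apply/setP=> e; rewrite !inE.
Qed.

Lemma kconn_deg (v : fV G) : kconn 3 G -> 1 < #|fV G| -> 3 <= deg v.
Proof.
move=> [_ kG] V1; have := kG [set v].
rewrite /deg card_darts => k3; apply: leq_trans (leq_addl _ _); apply: k3.
  by apply/set0Pn; exists v; rewrite inE.
by apply: contraTneq V1 => E; rewrite -cardsT -E cards1.
Qed.

Lemma kconn_edges_vertices : kconn 3 G -> 1 < #|fV G| -> 3 * #|fV G| <= 2 * #|fE G|.
Proof.
move=> kG V1; rewrite -dartsT -sum_deg mulnC -sum_nat_const.
rewrite [leqRHS](eq_bigl predT); last by move=> v; rewrite inE.
by apply: leq_sum => v _; apply: kconn_deg.
Qed.

Lemma kconn_card_bound : kconn 3 G -> #|fV G| <= #|fE G| + 1.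
Proof.
move=> kG; case: (ltnP 1 #|fV G|) => [V1|]; last by lia.
by have := kconn_edges_vertices kG V1; lia.
Qed.

(* A vertex of degree at most 2 can only occur on a one-vertex graph, whose genus is its number of loops. *)
Lemma fok_stable pure g (v : fV G) : 2 <= g -> fok pure g G -> fw v = 0 -> 3 <= deg v.
Proof.
move=> g2 [kG gG _] wv; case: (ltnP 1 #|fV G|) => [V1|V1]; first exact: kconn_deg.
have V1' : #|fV G| = 1 by case: kG => V0 _; lia.
have eqv u : u = v.
  by have /card_le1_eqP/(_ u v)->// : #|[set: fV G]| <= 1 by rewrite cardsT V1'.
move: gG; rewrite /fgenus V1' (bigD1 v) //= wv big1; last by move=> u; rewrite (eqv u) eqxx.
rewrite /deg (_ : [set v] = setT); first by rewrite dartsT !addn0 addnK => ->; lia.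
by apply/setP=> u; rewrite !inE (eqv u) eqxx.
Qed.

(** Degrees at least 3 give $3|V|\leq 2|E|$, hence $g-1\geq |E|-|V|\geq |E|/3$. A one-vertex graph
    has at most $g\leq 3g-3$ loops. *)
Lemma fok_edges pure g : 2 <= g -> fok pure g G -> #|fE G| <= 3 * g - 3.
Proof.
move=> g2 [kG gG _]; move: gG; rewrite /fgenus.
case: (ltnP 1 #|fV G|) => [V1|V1]; last by case: kG => ? _; lia.
by have := kconn_edges_vertices kG V1; lia.
Qed.

Lemma top_card g : top G -> fgenus G = g -> 2 <= g -> #|fV G| = 2 * g - 2 /\ #|fE G| = 3 * g - 3.
Proof.
move=> [kG wG c] gG g2; move: gG; rewrite /fgenus big1 ?addn0; first lia.
by move=> v _; exact: wG.
Qed.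

Lemma top_deg (v : fV G) : top G -> deg v = 3.
Proof.
move=> [kG _ c]; have V0 : 0 < #|fV G| by case: kG.
have V1 : 1 < #|fV G| by lia.
apply/eqP; rewrite eqn_leq kconn_deg // andbT leqNgt; apply/negP => dv.
suff: 3 * #|fV G| < 2 * #|fE G| by rewrite c ltnn.
rewrite -dartsT -sum_deg mulnC -sum_nat_const.
rewrite [leqRHS](eq_bigl predT); last by move=> u; rewrite inE.
rewrite (bigD1 v) // [leqRHS](bigD1 v) //= -addSn leq_add //.
by apply: leq_sum => u _; apply: kconn_deg.
Qed.

Lemma top_darts A : top G -> 3 * #|A| = 2 * #|inn A| + #|bnd A|.
Proof.
move=> tG; rewrite -card_darts -sum_deg mulnC -sum_nat_const.
by apply: eq_bigr => v _; rewrite top_deg.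
Qed.

Lemma not_top_big pure g : 2 <= g -> fok pure g G -> weightless G -> ~ top G ->
  exists v : fV G, 3 < deg v.
Proof.
move=> g2 ok wG nt; have [/existsP[v] dv|/existsPn dle] := boolP [exists v : fV G, 3 < deg v].
  by exists v.
case: nt; have [kG _ _] := ok; split=> //.
rewrite -dartsT -sum_deg mulnC -sum_nat_const.
rewrite [LHS](eq_bigl predT); last by move=> u; rewrite inE.
apply: eq_bigr => v _; apply/eqP; rewrite eqn_leq (fok_stable g2 ok (wG v)) andbT.
by rewrite leqNgt dle.
Qed.

End Counting.

(** * Isomorphisms and contractions *)

(* The bit [r e] records whether edge [e] is reversed. *)
Definition fiso (G H : fgraph) : Prop :=
  exists (s : fV G -> fV H) (t : fE G -> fE H) (r : fE G -> bool),
    [/\ bijective s, bijective t,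
        forall e b, att (t e) (b (+) r e) = s (att e b) &
        forall v, fw (s v) = fw v].

(** Contraction of the single edge [f], possibly a loop. In the last clause the terms before the sum
    are $b_1$ of the fibre over [v]: its edges, [f] or none, plus 1 minus its vertices. *)
Variant fcontr (G H : fgraph) : Prop := FContr (f : fE G)
    (pi : fV G -> fV H) (iota : fE H -> fE G) (r : fE H -> bool) of
  (forall v, exists u, pi u = v) &
  injective iota &
  (forall e, e <> f <-> exists e', iota e' = e) &
  (forall u v, pi u = pi v <-> u = v \/ exists b, u = att f b /\ v = att f (~~ b)) &
  (forall e b, pi (att (iota e) (b (+) r e)) = att e b) &
  (forall v, fw v = (pi (att f false) == v) + 1 - #|[set u | pi u == v]|
                    + \sum_(u | pi u == v) fw u).

Lemma fiso_refl G : fiso G G.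
Proof.
exists id, id, (fun=> false); split=> //; try by exists id.
by move=> e b; rewrite addbF.
Qed.

Lemma fiso_sym G H : fiso G H -> fiso H G.
Proof.
case=> s [t [r [[s' sK s'K] [t' tK t'K] att_st wt_s]]].
exists s', t', (fun e => r (t' e)); split; [by exists s|by exists t| |].
  move=> e b; apply: (can_inj sK); rewrite s'K -att_st t'K.
  by rewrite -addbA addbb addbF.
by move=> v; rewrite -wt_s s'K.
Qed.

Lemma fiso_trans G H K : fiso G H -> fiso H K -> fiso G K.
Proof.
case=> s [t [r [bs bt st ws]]] [s' [t' [r' [bs' bt' st' ws']]]].
exists (s' \o s), (t' \o t), (fun e => r e (+) r' (t e)); split=> /=.
- exact: bij_comp.
- exact: bij_comp.
- by move=> e b; rewrite addbA st' st.
- by move=> v; rewrite ws' ws.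
Qed.

(** A cut of [H] pulls back along [pi] to a cut of [G]. Collapsed edges do not cross the pullback,
    so its edges all come from edges of the original cut. *)
Lemma kconn_quotient k (G H : fgraph) (pi : fV G -> fV H)
    (iota : fE H -> fE G) (r : fE H -> bool) :
  (forall v, exists u, pi u = v) ->
  (forall e, pi (att e false) = pi (att e true) \/ exists e', iota e' = e) ->
  (forall e b, pi (att (iota e) (b (+) r e)) = att e b) ->
  kconn k G -> kconn k H.
Proof.
move=> pi_surj cover pi_att [V0 kG]; split.
  by case/card_gt0P: V0 => v _; apply/card_gt0P; exists (pi v).
move=> A /set0Pn[a aA] AT.
have /subsetPn[c _ cA] : ~~ ([set: fV H] \subset A) by rewrite subTset.
apply: (leq_trans (kG (pi @^-1: A) _ _)).
- by have [u Eu] := pi_surj a; apply/set0Pn; exists u; rewrite inE Eu.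
- have [u Eu] := pi_surj c; apply/eqP => /setP/(_ u).
  by rewrite !inE Eu (negPf cA).
- apply: leq_trans (leq_imset_card iota _); apply/subset_leq_card/subsetP => e.
  rewrite !inE; case: (cover e) => [-> | [e' <-] eb]; first by rewrite eqxx.
  apply/imsetP; exists e' => //; move: eb.
  by rewrite !inE -!pi_att; case: (r e') => //=; rewrite eq_sym.
Qed.

Lemma kconn_iso k (G H : fgraph) : fiso G H -> kconn k G -> kconn k H.
Proof.
move=> /fiso_sym[s [t [r [[s' sK s'K] [t' tK t'K] st _]]]].
apply: (@kconn_quotient k G H s' t r).
- by move=> v; exists (s v).
- by move=> e; right; exists (t' e).
- by move=> e b; rewrite st.
Qed.

Lemma kconn_contr k (G H : fgraph) : fcontr G H -> kconn k G -> kconn k H.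
Proof.
case=> f pi iota r surj inj cover ker pi_att _.
apply: (kconn_quotient surj _ pi_att) => e; have [->|/eqP ne] := eqVneq e f.
  by left; apply/ker; right; exists false.
by right; apply/cover.
Qed.

Lemma fiso_card (G H : fgraph) : fiso G H -> #|fV G| = #|fV H| /\ #|fE G| = #|fE H|.
Proof. by case=> s [t [r [/bij_eq_card-> /bij_eq_card-> _ _]]]. Qed.

Lemma fgenus_iso (G H : fgraph) : fiso G H -> fgenus G = fgenus H.
Proof.
move=> iso; rewrite /fgenus; have [-> ->] := fiso_card iso; congr (_ + _).
case: iso => s [t [r [bs _ _ ws]]].
rewrite [RHS](reindex s); last exact: onW_bij.
by apply: eq_bigr => v _; rewrite ws.
Qed.

Lemma weightless_iso (G H : fgraph) : fiso G H -> weightless G -> weightless H.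
Proof.
case=> s [t [r [[s' sK s'K] _ _ ws]]] wG v.
by rewrite -(s'K v) ws wG.
Qed.

Lemma fok_iso pure g (G H : fgraph) : fiso G H -> fok pure g G -> fok pure g H.
Proof.
move=> iso [kG gG pG]; split; first exact: kconn_iso kG.
  by rewrite -(fgenus_iso iso).
by move/pG; apply: weightless_iso.
Qed.

Lemma top_iso (G H : fgraph) : fiso G H -> top G -> top H.
Proof.
move=> iso [kG wG cG]; have [cV cE] := fiso_card iso.
split; [exact: kconn_iso kG | exact: weightless_iso wG | by rewrite -cV -cE].
Qed.

Lemma fcontr_iso_r G H K : fcontr G H -> fiso H K -> fcontr G K.
Proof.
case=> f pi iota r surj inj cover ker pi_att wpi.
case=> s [t [r' [[s' sK s'K] [t' tK t'K] st ws]]].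
have fibre v u : (s (pi u) == v) = (pi u == s' v) by exact: can2_eq.
apply: (@FContr G K f (s \o pi) (iota \o t') (fun e => r (t' e) (+) r' (t' e))) => /=.
- by move=> v; have [u Eu] := surj (s' v); exists u; rewrite Eu s'K.
- by apply: inj_comp => //; exact: can_inj t'K.
- move=> e; rewrite cover; split=> -[e' <-]; first by exists (t e'); rewrite tK.
  by exists (t' e').
- by move=> u v; rewrite -ker; split=> [/(can_inj sK)|->].
- move=> e b; rewrite [r _ (+) _]addbC addbA pi_att -st.
  by rewrite -addbA addbb addbF t'K.
- move=> v; rewrite -{1}(s'K v) ws wpi fibre; congr (_ - _ + _).
    by apply: eq_card => u; rewrite !inE fibre.
  by apply: eq_bigl => u; rewrite fibre.
Qed.

Lemma fcontr_iso_l G H K : fiso G K -> fcontr G H -> fcontr K H.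
Proof.
move=> iso; case=> f pi iota r surj inj cover ker pi_att wpi.
case: iso => s [t [r' [[s' sK s'K] [t' tK t'K] st ws]]].
have att' e b : s' (att (t e) b) = att e (b (+) r' e).
  by rewrite -(sK (att _ _)) -st -addbA addbb addbF.
apply: (@FContr K H (t f) (pi \o s') (t \o iota) (fun e => r e (+) r' (iota e))) => /=.
- by move=> v; have [u Eu] := surj v; exists (s u); rewrite sK.
- by apply: inj_comp => //; exact: can_inj tK.
- move=> e; split=> [ne|[e' <-] /(can_inj tK) E].
    have /cover[e' Ee] : t' e <> f by move=> E; apply: ne; rewrite -E t'K.
    by exists e'; rewrite Ee t'K.
  by move: E; apply/cover; exists e'.
- move=> u v; rewrite ker; split=> -[E|[b [Eu Ev]]].
  + by left; apply: can_inj E; exact: s'K.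
  + right; exists (b (+) r' f); rewrite -(s'K u) -(s'K v) Eu Ev -!st; split=> //.
    by rewrite addNb.
  + by left; rewrite E.
  + right; exists (b (+) r' f); rewrite Eu Ev !att' -addNb; split=> //.
- move=> e b; rewrite att' addbA -addbA addbb addbF; exact: pi_att.
- move=> v; rewrite wpi att'; congr (_ - _ + _).
  + congr (_ + _); congr ((_ == _) : nat).
    by apply/ker; case: (r' f) => /=; [right; exists false | left].
  + rewrite -(card_imset _ (can_inj sK)); apply: eq_card => u; rewrite !inE.
    apply/imsetP/idP => [[x + ->]|H1]; first by rewrite inE sK.
    by exists (s' u); rewrite ?inE ?s'K.
  + rewrite [RHS](reindex s) /=; last by exists s' => x _; rewrite ?sK ?s'K.
    by apply: eq_big => u; rewrite ?sK ?ws.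
Qed.

(** * Expansions *)

Definition add_loop (G : fgraph) (v : fV G) : fgraph :=
  @FGraph (fV G) (option (fE G)) (fun e b => if e is Some e then att e b else v)
    (fun u => if u == v then (fw u).-1 else fw u).

Lemma add_loop_contr (G : fgraph) (v : fV G) : 0 < fw v -> fcontr (add_loop v) G.
Proof.
move=> wv; apply: (@FContr (add_loop v) G None id Some (fun=> false)) => /=.
- by move=> u; exists u.
- by move=> e e' [].
- by move=> [e|]; split=> //; [exists e | case].
- by move=> x y; split=> [|[//|[b [-> ->]]]] //; left.
- by move=> e b; rewrite addbF.
- move=> u; rewrite cardsE card1 big_pred1_eq eq_sym addnK.
  by case: eqP => [->|]; lia.
Qed.

Lemma add_loop_ok g (G : fgraph) (v : fV G) : fok false g G -> 0 < fw v ->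
  fok false g (add_loop v).
Proof.
move=> [kG gG _] wv; split=> //.
  case: (kG) => V0 k3; split=> // A A0 AT; apply: leq_trans (k3 A A0 AT) _.
  rewrite -(card_imset _ (@Some_inj _)); apply/subset_leq_card/subsetP => e.
  by case/imsetP => e' + ->; rewrite !inE.
(* The bound $|V|\leq |E|+1$ keeps the truncated subtraction exact, so that the new loop adds the 1
   that the weight at [v] loses. *)
rewrite -gG /fgenus /= card_option; have := kconn_card_bound kG.
rewrite (bigD1 v) //= eqxx [in RHS](bigD1 v) //= => bE.
rewrite (eq_bigr (fun u => fw u)); first by lia.
by move=> u /negPf->.
Qed.

Section Split.
Variables (G : fgraph) (v : fV G) (h1 h2 : fE G * bool).

(* The edge ends [h1] and [h2] are moved from [v] to the new vertex [None], which the new edge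
   [None] joins to [v]. *)
Definition split_graph : fgraph :=
  @FGraph (option (fV G)) (option (fE G))
    (fun e b => if e is Some e then
                  if ((e, b) == h1) || ((e, b) == h2) then None else Some (att e b)
                else if b then Some v else None)
    (fun u => if u is Some u then fw u else 0).

Let far (h : fE G * bool) := att h.1 (~~ h.2).

Hypothesis h1v : att h1.1 h1.2 = v.
Hypothesis h2v : att h2.1 h2.2 = v.
Hypothesis h12 : h1.1 != h2.1.

Let hv e b : ((e, b) == h1) || ((e, b) == h2) -> att e b = v.
Proof. by case/orP => /eqP E; [move: h1v | move: h2v]; rewrite -E. Qed.

Lemma split_contr : fcontr split_graph G.
Proof.
apply: (@FContr split_graph G None (fun u => if u is Some u then u else v)
          Some (fun=> false)) => /=.
- by move=> u; exists (Some u).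
- by move=> e e' [].
- by move=> [e|]; split=> //; [exists e | case].
- move=> x y; split=> [|[->//|[b]]]; last by case: b => -[-> ->].
  case: x y => [x|] [y|] E; subst; try by left.
    by right; exists true.
  by right; exists false.
- move=> e b; rewrite addbF; case: ifP => // /hv->//.
- move=> u; rewrite eq_sym; have [->|uv] := eqVneq u v.
    have Es : [set w : option (fV G) | (if w is Some w then w else v) == v] = [set None; Some v].
      by apply/setP => -[w|]; rewrite !inE ?eqxx.
    rewrite Es cards2 /= subnn add0n -big_set Es big_setU1 ?inE //= big_set1.
    by rewrite add0n.
  have Es : [set w : option (fV G) | (if w is Some w then w else v) == u] = [set Some u].
    by apply/setP => -[w|]; rewrite !inE //= eq_sym (negPf uv).
  by rewrite Es cards1 /= subnn add0n -big_set Es big_set1.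
Qed.

Hypothesis kG : kconn 3 G.
Hypothesis good : forall B : {set fV G}, v \notin B -> far h1 \in B -> far h2 \in B ->
  3 < #|bnd B|.

(** The new edge crosses, so two more edges are needed. The cut that [A] induces in [G] has at least
    3 edges and loses those of [h1], [h2] whose far end lies in [A]. If only one is lost, two
    remain; if both are, [good] provides a fourth edge to start from. *)
Lemma split_bnd (A : {set fV split_graph}) : None \in A -> Some v \notin A -> 2 < #|bnd A|.
Proof.
move=> NA vA; pose B := [set u | Some u \in A]; pose D := [set e | Some e \in bnd A].
suff D2 : 1 < #|D|.
  apply: (@leq_trans #|None |: [set Some e | e in D]|).
    rewrite cardsU1 card_imset; last exact: Some_inj.
    rewrite (_ : None \notin _) //; by apply/imsetP => -[].
  apply/subset_leq_card/subsetP => -[e|]; rewrite !inE /=.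
    by case/imsetP => e' + [->]; rewrite !inE.
  by rewrite NA (negPf vA).
have vB : v \notin B by rewrite inE.
(* Here [A] is the new vertex alone, and the edges of [h1] and [h2] both leave it. *)
have [B0|B0] := eqVneq B set0.
  have nA u : Some u \in A = false.
    by apply/negP => uA; by have := in_set0 u; rewrite -B0 inE uA.
  have hA h : (h == h1) || (h == h2) -> Some h.1 \in bnd A.
    case: h => e b hh.
    have nh : ((e, ~~ b) == h1) || ((e, ~~ b) == h2) = false.
      apply/negP => /orP nh; move: h12; case/orP: hh => /eqP E1; case: nh => /eqP E2.
      - by case: (etrans E1 (esym E2)); case: (b).
      - by rewrite -E1 -E2 eqxx.
      - by rewrite -E1 -E2 eqxx.
      - by case: (etrans E1 (esym E2)); case: (b).
    by rewrite inE; case: b hh nh => /= -> ->; rewrite NA nA.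
  apply: (@leq_trans #|[set h1.1; h2.1]|); first by rewrite cards2 h12.
  apply/subset_leq_card/subsetP => e; rewrite in_set2 => /orP[]/eqP->; rewrite in_set;
    by apply: hA; rewrite eqxx ?orbT.
have BT : B != setT by apply: contraNneq vB => ->.
have k3 : 2 < #|bnd B| by case: kG => _; apply.
(* The lost edges: moving their end from [v] to the new vertex puts both ends in [A]. *)
pose X := [set e | (e == h1.1) && (far h1 \in B) || (e == h2.1) && (far h2 \in B)].
have sub : bnd B :\: X \subset D.
  apply/subsetP => e; rewrite in_setD => /andP[eX eB].
  have nh b : ((e, b) == h1) || ((e, b) == h2) = false.
    apply/negP => hh; have bv := hv hh; move: eX.
    have : att e (~~ b) \in B.
      by move: eB; rewrite inE; case: b hh bv => hh bv; rewrite bv (negPf vB) //=; case: (_ \in B).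
    case/orP: hh => /eqP E fB; rewrite inE negb_or.
      by rewrite /far -E /= eqxx fB.
    by rewrite [X in _ && X](_ : _ = false) ?andbF // /far -E /= eqxx fB.
  by rewrite inE inE /= !nh; move: eB; rewrite !inE.
apply: leq_trans (subset_leq_card sub); rewrite cardsD.
apply: (@leq_trans (#|bnd B| - #|X|)); last exact/leq_sub2l/subset_leq_card/subsetIr.
have [f1|f1] := boolP (far h1 \in B); have [f2|f2] := boolP (far h2 \in B).
- apply: leq_trans (leq_sub2r _ (good vB f1 f2)).
  have: #|X| <= #|[set h1.1; h2.1]|.
    by apply/subset_leq_card/subsetP => e; rewrite in_set2 [e \in X]in_set f1 f2 !andbT.
  by rewrite cards2 h12 => XX; apply: leq_trans (leq_sub2l _ XX).
- have: #|X| <= #|[set h1.1]|.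
    by apply/subset_leq_card/subsetP => e; rewrite in_set1 [e \in X]in_set f1 (negPf f2) !andbT andbF orbF.
  by rewrite cards1 => XX; apply: leq_trans (leq_sub2l _ XX); rewrite ltn_subRL.
- have: #|X| <= #|[set h2.1]|.
    by apply/subset_leq_card/subsetP => e; rewrite in_set1 [e \in X]in_set f2 (negPf f1) !andbT andbF.
  by rewrite cards1 => XX; apply: leq_trans (leq_sub2l _ XX); rewrite ltn_subRL.
- have: #|X| <= #|@set0 (fE G)|.
    by apply/subset_leq_card/subsetP => e; rewrite in_set0 [e \in X]in_set (negPf f1) (negPf f2) !andbF.
  by rewrite cards0 => XX; apply: leq_trans (leq_sub2l _ XX); rewrite subn0 ltnW.
Qed.

(** A cut with [None] and [Some v] on the same side is a cut of [G]; one that separates them falls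
    under [split_bnd], up to complement. *)
Lemma split_kconn : kconn 3 split_graph.
Proof.
split; first by rewrite /= card_option.
move=> A A0 AT; have [NA|NA] := boolP (None \in A); have [vA|vA] := boolP (Some v \in A).
2: exact: split_bnd.
2: by rewrite -bndC; apply: split_bnd; rewrite inE // negbK.
all: pose B := [set u | Some u \in A].
all: have attB e b : ((att (Some e : fE split_graph) b : fV split_graph) \in A) = (att e b \in B)
  by rewrite inE /=; case: ifP => // /hv ->; rewrite ?NA ?vA ?(negPf NA) ?(negPf vA).
all: have leB : #|bnd B| <= #|bnd A| by
  rewrite -(card_imset _ (@Some_inj _)); apply/subset_leq_card/subsetP => e;
  case/imsetP => e' + ->; rewrite [_ \in bnd B]in_set [_ \in bnd A]in_set !attB.
all: apply: leq_trans leB; case: kG => _; apply.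
- by apply/set0Pn; exists v; rewrite inE.
- apply: contraNneq AT => BT; apply/eqP/setP => -[u|]; rewrite inE // -[RHS](in_setT u) -BT inE //.
- case/set0Pn: A0 => -[u|] uA; last by rewrite uA in NA.
  by apply/set0Pn; exists u; rewrite inE.
- by apply: contraNneq vA => BT; have := in_setT v; rewrite -BT inE.
Qed.

End Split.

Lemma kconn_bnd k (G : fgraph) (A : {set fV G}) u w :
  kconn k G -> u \in A -> w \notin A -> k <= #|bnd A|.
Proof.
move=> [_ kG] uA wA; apply: kG; first by apply/set0Pn; exists u.
by apply: contraNneq wA => ->.
Qed.

(* The sides of 3-edge cuts that avoid [v] and contain the far end of [h1] are closed under
   union, so it suffices that the far end of [h2] lies outside the largest of them. *)
Lemma good_pair (G : fgraph) (v : fV G) : kconn 3 G -> 3 < deg v ->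
  exists h1 h2 : fE G * bool,
  [/\ att h1.1 h1.2 = v, att h2.1 h2.2 = v, h1.1 != h2.1 &
      forall B : {set fV G}, v \notin B -> att h1.1 (~~ h1.2) \in B ->
        att h2.1 (~~ h2.2) \in B -> 3 < #|bnd B|].
Proof.
move=> kG dv; pose far (h : fE G * bool) := att h.1 (~~ h.2).
have /card_gt0P[h1] : 0 < deg v by lia.
rewrite !inE => /eqP h1v.
pose P (B : {set fV G}) := [&& #|bnd B| == 3, v \notin B & far h1 \in B].
(* If there is no such cut, any dart at [v] off the edge of [h1] serves; one exists since that edge
   accounts for at most two of the more than three darts. *)
have [B0 PB0|noP] := pickP P; last first.
  have /subsetPn[h2 h2v h2n] : ~~ (darts [set v] \subset [set (h1.1, true); (h1.1, false)]).
    by apply/negP => /subset_leq_card; rewrite cards2 -/(deg v); case: (_ != _) => /=; lia.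
  exists h1, h2; split=> //; first by move: h2v; rewrite !inE => /eqP.
    by apply: contraNneq h2n => ->; rewrite !inE (surjective_pairing h2) !xpair_eqE eqxx; case: (h2.2).
  move=> B vB f1 f2; rewrite ltn_neqAle (kconn_bnd kG f1 vB) andbT.
  by apply/negP => B3; have := noP B; rewrite /P eq_sym B3 vB f1.
case: (@arg_maxnP _ B0 P (fun B => #|B|) PB0) => B /and3P[/eqP B3 vB f1] maxB.
(* If every far end lay in [B], which avoids [v], no edge at [v] would be a loop, and more than
   three distinct edges would cross the 3-edge cut. *)
have /subsetPn[h2 h2v f2] : ~~ (darts [set v] \subset [set h | far h \in B]).
  apply/negP => /subsetP sub.
  have inj : {in darts [set v] &, injective (fun h : fE G * bool => h.1)}.
    move=> [e b] [e' b'] /=; rewrite !inE /= => /eqP ev ev' E; subst e'; congr (_, _).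
    apply/eqP; apply: contraTT vB => bb'; rewrite negbK.
    have := sub (e, b'); rewrite !inE /= ev' => /(_ isT); rewrite /far /=.
    by rewrite (_ : ~~ b' = b) ?ev //; case: b b' bb' {ev ev'} => -[].
  move: dv; rewrite /deg -(card_in_imset inj) ltnNge => /negP; apply.
  rewrite -B3; apply/subset_leq_card/subsetP => e /imsetP[[e' b] hv ->] /=.
  have := sub _ hv; move: hv; rewrite !inE /far /= => /eqP ev.
  by case: b ev => /= ->; rewrite (negPf vB) => ->.
move: h2v f2; rewrite !inE => /eqP h2v f2; exists h1, h2; split=> //.
  apply: contraNneq f2 => E; rewrite /far -E.
  have [<-//|ne] := eqVneq h1.2 h2.2.
  have Eb : ~~ h1.2 = h2.2 by case: (h1.2) (h2.2) ne => -[].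
  by move: f1; rewrite /far Eb E h2v (negPf vB).
move=> C vC g1 g2; rewrite ltn_neqAle (kconn_bnd kG g1 vC) andbT; apply/negP => /eqP C3.
have vU : v \notin B :|: C by rewrite inE negb_or vB.
have f1U : far h1 \in B :|: C by rewrite inE f1.
have f1I : far h1 \in B :&: C by rewrite inE f1.
have vI : v \notin B :&: C by rewrite inE negb_and vB.
have U3 := kconn_bnd kG f1U vU; have I3 := kconn_bnd kG f1I vI.
have := bnd_submod B C => sm.
have PU : P (B :|: C) by rewrite /P vU f1U; apply/andP; split=> //; apply/eqP;
  move: sm U3 I3; rewrite B3 -C3; clear; lia.
have : #|B :|: C| <= #|B| := maxB _ PU.
rewrite leqNgt => /negP; apply; apply/proper_card.
by apply/properP; split; [exact: subsetUl | exists (far h2); rewrite // inE g2 orbT].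
Qed.

Lemma expand pure g (G : fgraph) : 2 <= g -> fok pure g G -> ~ top G ->
  exists G' : fgraph, [/\ fok pure g G', #|fE G'| = #|fE G|.+1 & fcontr G' G].
Proof.
move=> g2 ok nt; have [/existsP[v wv]|/existsPn w0] := boolP [exists v : fV G, 0 < fw v].
  case: pure ok => ok; first by case: ok => _ _ /(_ isT)/(_ v) E; rewrite E in wv.
  exists (add_loop v); split; [exact: add_loop_ok | by rewrite /= card_option | exact: add_loop_contr].
have wG : weightless G by move=> v; apply/eqP; rewrite -leqn0 leqNgt w0.
have [v dv] := not_top_big g2 ok wG nt.
have [kG gG _] := ok; have [h1 [h2 [h1v h2v h12 good]]] := good_pair kG dv.
have w' : weightless (split_graph v h1 h2) by case=> [u|] //=; rewrite wG.
exists (split_graph v h1 h2); split; [|by rewrite /= card_option|exact: split_contr].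
split=> //; first exact: (split_kconn h1v h2v h12 kG good).
rewrite -gG /fgenus /= !card_option !big1 // => u _; exact: w'.
Qed.

Inductive fexpands (pure : bool) (g : nat) : fgraph -> fgraph -> Prop :=
| fexpands_refl G : fexpands pure g G G
| fexpands_step G G1 G2 : fok pure g G1 -> #|fE G1| = #|fE G|.+1 -> fcontr G1 G ->
    fexpands pure g G1 G2 -> fexpands pure g G G2.

(** Induction on the codimension $3g-3-|E|$, which [fok_edges] keeps meaningful and each expansion
    lowers by one. *)
Lemma expand_to_top pure g (G : fgraph) : 2 <= g -> fok pure g G ->
  exists G', [/\ fok pure g G', top G' & fexpands pure g G G'].
Proof.
move=> g2; have [m] := ubnP (3 * g - 3 - #|fE G|); elim: m G => // m IH G lem ok.
have [kG _ _] := ok.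
have [/eqP c|/eqP c] := boolP (2 * #|fE G| == 3 * #|fV G|); last first.
  have [|G1 [ok1 c1 con]] := expand g2 ok; first by case.
  have [|//|G2 [ok2 t2 ex2]] := IH G1.
    by have := fok_edges g2 ok1; lia.
  by exists G2; split=> //; apply: fexpands_step ex2.
have [wG|[v wv]] : weightless G \/ exists v : fV G, fw v <> 0.
  have [/existsP[v /eqP wv]|/existsPn w0] := boolP [exists v : fV G, fw v != 0].
    by right; exists v.
  by left=> v; apply/eqP; have := w0 v; rewrite negbK.
  by exists G; split=> //; apply: fexpands_refl.
have [|G1 [ok1 c1 con]] := expand g2 ok; first by case=> _ /(_ v).
have [|//|G2 [ok2 t2 ex2]] := IH G1.
  by have := fok_edges g2 ok1; lia.
by exists G2; split=> //; apply: fexpands_step ex2.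
Qed.

(** * Whitehead moves *)

Definition gr (V E : finType) (a : E -> bool -> V) : fgraph := @FGraph V E a (fun=> 0).

(* A Whitehead move at the edge [f], keeping the names of vertices and edges: some of the
   other edge ends at the two endpoints of [f] trade endpoints. *)
Definition flip (V E : finType) (a a' : E -> bool -> V) : Prop :=
  exists f, [/\ a f false <> a f true, forall b, a' f b = a f b &
    forall e b, a' e b = a e b \/ exists c, a e b = a f c /\ a' e b = a f (~~ c)].

Section Contract.
Variables (V E : finType) (a : E -> bool -> V) (f : E).
Hypothesis nloop : a f false != a f true.

Let p' : {v : V | v != a f true} := Sub (a f false) nloop.
(** The endpoint [a f true] is dropped and merged into [a f false], which is the default value of
    [insubd]. *)
Definition quo (v : V) : {v : V | v != a f true} := insubd p' v.

Definition contract : fgraph := gr (fun (e : {e : E | e != f}) b => quo (a (val e) b)).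

Lemma val_quo v : val (quo v) = if v == a f true then a f false else v.
Proof. by rewrite /quo val_insubd; case: (v == _). Qed.

Lemma quo_eq u v : quo u = quo v <-> u = v \/ exists b, u = a f b /\ v = a f (~~ b).
Proof.
split=> [/(congr1 val)|[->//|[b [-> ->]]]]; last first.
  by apply: val_inj; rewrite !val_quo; case: b => /=; rewrite eqxx (negPf nloop).
rewrite !val_quo; case: eqP => [->|_]; case: eqP => [->|_] E1; try by left.
  by right; exists true.
by right; exists false; rewrite E1.
Qed.

(** Stated for any attachment that agrees with [a] after the quotient, so that one contracted graph
    serves both sides of a flip. *)
Lemma contract_contr (a' : E -> bool -> V) :
  (forall b, a' f b = a f b) -> (forall e b, quo (a' e b) = quo (a e b)) ->
  fcontr (gr a') contract.
Proof.
move=> ef ea; apply: (@FContr (gr a') contract f quo val (fun=> false)) => /=.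
- by move=> v; exists (val v); rewrite /quo valKd.
- exact: val_inj.
- move=> e; split=> [/eqP ne|[e' <-]]; first by exists (Sub e ne); rewrite SubK.
  by apply/eqP; exact: valP e'.
- move=> u v; rewrite quo_eq; split=> -[E1|[b [E1 E2]]]; try (by left).
    by right; exists b; rewrite !ef.
  by right; exists b; rewrite -!ef.
- by move=> e b; rewrite addbF ea.
- move=> v; rewrite big1 // addn0; apply/esym/eqP; rewrite subn_eq0 ef.
  have [Ev|_] := eqVneq (quo (a f false)) v; last first.
    apply/card_gt0P; exists (val v); rewrite inE; apply/eqP.
    by rewrite /quo valKd.
  apply: (@leq_trans #|[set a f false; a f true]|); first by rewrite cards2 nloop.
  apply/subset_leq_card/subsetP => u; rewrite !inE => /orP[]/eqP->; apply/eqP => //.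
  by rewrite -Ev; apply/quo_eq; right; exists true.
Qed.
End Contract.

(** The traded ends move between the endpoints of [f], which contracting [f] identifies. The common
    contraction is the codimension-one stratum between the two cubic ones. *)
Lemma flip_common pure (V E : finType) (a a' : E -> bool -> V) :
  flip a a' -> top (gr a) ->
  exists H, [/\ fok pure (#|E| + 1 - #|V|) H, #|fE H|.+1 = #|E|,
               fcontr (gr a) H & fcontr (gr a') H].
Proof.
case=> f [/eqP ne ef fl] tG; exists (contract ne).
have con : fcontr (gr a) (contract ne) by apply: contract_contr.
have cE : #|fE (contract ne)|.+1 = #|E|.
  by rewrite /= card_sig (cardC1 f) prednK //; apply/card_gt0P; exists f.
have cV : #|fV (contract ne)|.+1 = #|V|.
  by rewrite /= card_sig (cardC1 (a f true)) prednK //; apply/card_gt0P; exists (a f true).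
split=> //; last first.
  apply: contract_contr => // e b; apply/quo_eq; case: (fl e b) => [->|[c [-> ->]]]; [by left|].
  by right; exists (~~ c); rewrite negbK.
split=> //; first by apply: (kconn_contr con); case: tG.
by rewrite /fgenus big1 //; lia.
Qed.

Lemma bndE (G : fgraph) (A : {set fV G}) e b :
  (e \in bnd A) = ((att e b \in A) != (att e (~~ b) \in A)).
Proof. by rewrite inE; case: b; rewrite // eq_sym. Qed.

(** * Subdividing two edges and joining the new vertices *)

Section Add.
Variable G : fgraph.
Implicit Type h : bool -> fE G * bool.

(* The edges carrying the darts [h false] and [h true] are subdivided by the new vertices
   [inr false] and [inr true], which are joined by the new edge [inr None]; the new edge
   [inr (Some i)] is the half of the subdivided edge next to the vertex of [h i]. *)
Definition add_att h (e : fE G + option bool) (b : bool) : fV G + bool :=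
  match e with
  | inl e => if (e, b) == h false then inr false
             else if (e, b) == h true then inr true else inl (att e b)
  | inr None => inr b
  | inr (Some i) => if b then inr i else inl (att (h i).1 (h i).2)
  end.

Definition add h : fgraph := gr (add_att h).

Definition separate h := (h false).1 != (h true).1.

Lemma separateP h i : separate h -> (h i).1 != (h (~~ i)).1.
Proof. by rewrite /separate; case: i; rewrite // eq_sym. Qed.

Lemma add_att_dart h i : separate h -> add_att h (inl (h i).1) (h i).2 = inr i.
Proof.
rewrite /separate /= -surjective_pairing; case: i; rewrite eqxx // => s.
by case: eqP => // E; rewrite E eqxx in s.
Qed.

Lemma add_att_other h e b : (forall i, (e, b) <> h i) -> add_att h (inl e) b = inl (att e b).
Proof. by move=> ne /=; do 2!case: eqP => [/ne//|_]. Qed.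

Lemma add_att_far h i : separate h ->
  add_att h (inl (h i).1) (~~ (h i).2) = inl (att (h i).1 (~~ (h i).2)).
Proof.
move=> s; apply: add_att_other => j E; have [Eij|/eqP] := eqVneq i j.
  by move: E; rewrite Eij; case: (h j) => e [].
case: i j E s => -[] //; rewrite /separate => E; rewrite -E eqxx //.
Qed.

(** Such a set consists of new vertices. Both halves of the edge subdivided by [inr i] leave it; the
    third crossing edge is the joining edge, or a half at the other new vertex when that one also
    lies in [A]. *)
Lemma add_bnd_out h (A : {set fV (add h)}) : separate h -> A != set0 ->
  (forall v, inl v \notin A) -> 2 < #|bnd A|.
Proof.
move=> s /set0Pn[[v|i] iA] nA; first by rewrite (negPf (nA v)) in iA.
pose j : option bool := if inr (~~ i) \in A then Some (~~ i) else None.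
pose S : {set fE (add h)} := inr (Some i) |: (inl (h i).1 |: [set inr j]).
have <- : #|S| = 3.
  by rewrite !cardsU1 !inE cards1 /j; case: ifP => _; rewrite !eqE /=; case: i {iA j S}.
apply/subset_leq_card/subsetP => e; rewrite in_setU1 in_setU1 in_set1.
case/or3P=> /eqP->; rewrite inE.
- by rewrite /= iA (negPf (nA _)).
- have D : att (inl (h i).1 : fE (add h)) (h i).2 \in A by rewrite [att _ _](add_att_dart i s).
  have F : att (inl (h i).1 : fE (add h)) (~~ (h i).2) \in A = false.
    by rewrite [att _ _](add_att_far i s); exact/negbTE.
  by case: (h i).2 D F => -> ->.
- rewrite /j; case: ifP => jA /=; first by rewrite jA (negPf (nA _)).
  by case: i iA jA {S j} => /= -> ->.
Qed.

(** If old vertices lie on both sides, each edge of the induced cut of [G] yields a crossing edge: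
    itself, or one of its halves if it is subdivided. Otherwise [add_bnd_out] applies to one
    side. *)
Lemma add_kconn h : separate h -> kconn 3 G -> kconn 3 (add h).
Proof.
move=> s [V0 kG]; split; first by rewrite card_sum ltn_addr.
move=> A A0 AT; pose B := [set v | inl v \in A].
have [BE|B0] := eqVneq B set0.
  by apply: add_bnd_out => // v; apply/negP => vA; have := in_set0 v; rewrite -BE inE vA.
have [BE|BT] := eqVneq B setT.
  rewrite -bndC; apply: add_bnd_out => //.
    by apply: contraNneq AT => E; rewrite -(setCK A) E setC0.
  by move=> v; rewrite inE negbK; have := in_setT v; rewrite -BE inE.
apply: leq_trans (kG B B0 BT) _.
(* For a marked edge the boolean [e != (h false).1] is the index [i] with [e = (h i).1]. *)
pose phi e : fE (add h) := if (inl e : fE (add h)) \in bnd A then inl e else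
  inr (Some (e != (h false).1)).
have cross e : e \in bnd B -> (inl e : fE (add h)) \notin bnd A ->
    exists i, e = (h i).1 /\ (inr (Some i) : fE (add h)) \in bnd A.
  have [/existsP[i /eqP Ei]|/existsPn nE] := boolP [exists i, e == (h i).1].
    move=> eB eA; exists i; split=> //; move: eA eB.
    rewrite [e \in _](bndE _ _ (h i).2) [inl e \in _](bndE _ _ (h i).2) [inr _ \in _](bndE _ _ true) Ei.
    rewrite [att _ _](add_att_dart i s) [att _ _](add_att_far i s) /= ![_ \in B]in_set.
    by case: (inr i \in A); case: (inl _ \in A); case: (inl _ \in A).
  have nh b i : (e, b) <> h i by move=> E; have := nE i; rewrite -E eqxx.
  rewrite inE => eB /negP[]; rewrite inE /= -!/(add_att h (inl e) _).
  by rewrite !add_att_other //; move: eB; rewrite !inE.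
have phiP e : e \in bnd B -> phi e \in bnd A /\
    (phi e = inl e \/ exists i, phi e = inr (Some i) /\ e = (h i).1).
  move=> eB; rewrite /phi; case: ifP => [eA|/negbT/(cross e eB)[i [Ei iA]]]; first by split; [|left].
  have -> : (e != (h false).1) = i by rewrite Ei; case: (i); rewrite ?eqxx // eq_sym (s : _ != _).
  by split=> //; right; exists i.
have phi_inj : {in bnd B &, injective phi}.
  move=> e e' /phiP[_ [->|[i [-> ->]]]] /phiP[_ [->|[i' [-> ->]]]] //; first by case.
  by case=> ->.
rewrite -(card_in_imset phi_inj); apply/subset_leq_card/subsetP => e.
by case/imsetP => e' /phiP[+ _] ->.
Qed.

Lemma add_card h : #|fV (add h)| = #|fV G| + 2 /\ #|fE (add h)| = #|fE G| + 3.
Proof. by rewrite /= !card_sum card_option card_bool. Qed.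

Lemma add_top h : separate h -> top G -> top (add h).
Proof.
move=> s [kG wG cG]; split=> //; first exact: add_kconn.
by have [-> ->] := add_card h; lia.
Qed.

End Add.

(** Flips keep the vertex and edge types, so isomorphisms are included to rename; every graph on the
    way satisfies [top]. *)
Inductive flink : fgraph -> fgraph -> Prop :=
| flink_iso G H : top G -> fiso G H -> flink G H
| flink_flip (V E : finType) (a a' : E -> bool -> V) :
    top (gr a) -> top (gr a') -> flip a a' -> flink (gr a) (gr a')
| flink_trans G H K : flink G H -> flink H K -> flink G K.

Lemma flink_top G H : flink G H -> top G /\ top H.
Proof.
elim=> {G H} [G H tG iso|//|G H K _ [tG _] _ [_ tK]] //.
by split=> //; exact: top_iso iso tG.
Qed.

(** * Sliding the ends of the joining edge *)

Section Slide.
Variable G : fgraph.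
Hypothesis tG : top G.
Implicit Type h : bool -> fE G * bool.

(** The flip is at the half [inr (Some i)], which joins [inr i] to the common vertex of the darts
    [h i] and [h' i]: these two darts trade places. *)
Lemma slide_flip h h' i : separate h -> separate h' -> h' (~~ i) = h (~~ i) ->
  att (h' i).1 (h' i).2 = att (h i).1 (h i).2 -> flip (add_att h) (add_att h').
Proof.
move=> s s' Eo Ev; exists (inr (Some i)); split=> // [[]//=|]; first by rewrite Ev.
have Ej j : j != i -> h' j = h j by case: i j Eo {Ev} => -[].
have same d j : d = h j -> d = h' j -> add_att h' (inl d.1) d.2 = add_att h (inl d.1) d.2.
  by move=> -> E; rewrite add_att_dart // E add_att_dart.
move=> [e|[j|]] b; last by left.
- have [/existsP[j /eqP E]|/existsPn nh] := boolP [exists j, (e, b) == h j];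
  have [/existsP[j' /eqP E']|/existsPn nh'] := boolP [exists j, (e, b) == h' j].
  + have [Ejj|njj] := eqVneq j j'; first by left; subst j'; apply: (same (e, b) j).
    have [Eji|nji] := eqVneq j i.
      have E2 : h' j' = h j' by apply: Ej; rewrite -Eji eq_sym.
      have := separateP j s; rewrite -E (_ : ~~ j = j'); last by case: j j' njj {E E' Eji E2} => -[].
      by rewrite -E2 -E' eqxx.
    have E2 := Ej j nji; have := separateP j s'; rewrite E2 -E (_ : ~~ j = j'); last by case: j j' njj {E E' nji E2} => -[].
    by rewrite -E' eqxx.
  + have Eji : j = i by apply/eqP; apply: contraT => /Ej E2; have := nh' j; rewrite E2 -E eqxx.
    right; exists true; rewrite [add_att h' _ _]add_att_other; last first.
      by move=> k E2; have := nh' k; rewrite E2 eqxx.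
    have := add_att_dart j s; rewrite -E => -> /=; rewrite Eji; split=> //.
    by rewrite -Eji -E.
  + have Eji : j' = i by apply/eqP; apply: contraT => /Ej E2; have := nh j'; rewrite -E2 -E' eqxx.
    right; exists false; rewrite [add_att h _ _]add_att_other; last first.
      by move=> k E2; have := nh k; rewrite E2 eqxx.
    have := add_att_dart j' s'; rewrite -E' => -> /=; rewrite Eji; split=> //.
    by rewrite -Ev -Eji -E'.
  + left; rewrite !add_att_other // => k E2; [have := nh k|have := nh' k]; by rewrite E2 eqxx.
- left; case: b => //=; have [->|/Ej->//] := eqVneq j i; by rewrite Ev.
Qed.

Lemma slide_flink h h' i : separate h -> separate h' -> h' (~~ i) = h (~~ i) ->
  att (h' i).1 (h' i).2 = att (h i).1 (h i).2 -> flink (add h) (add h').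
Proof.
move=> s s' Eo Ev; apply: flink_flip; [exact: add_top|exact: add_top|].
exact: slide_flip Ev.
Qed.

(* Reversing the marked dart only exchanges the two halves of the subdivided edge. *)
Lemma reverse_iso h h' i : separate h -> h' (~~ i) = h (~~ i) ->
  h' i = ((h i).1, ~~ (h i).2) -> fiso (add h) (add h').
Proof.
move=> s Eo Ei; set e0 := (h i).1; set c := (h i).2.
have s' : separate h'.
  by move: s; rewrite /separate; case: i Eo Ei {e0 c} => /= -> ->.
have ne0 : e0 != (h (~~ i)).1 by apply: separateP.
pose t (x : fE G + option bool) := if x == inl e0 then inr (Some i)
   else if x == inr (Some i) then inl e0 else x.
have tK : cancel t t.
  move=> x; rewrite /t; have [->|n1] := eqVneq x (inl e0).
    by rewrite eqxx; case: eqP.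
  by have [->|n2] := eqVneq x (inr (Some i)); rewrite ?eqxx ?(negPf n1) ?(negPf n2).
exists id, t, (fun x => if x == inl e0 then ~~ c else if x == inr (Some i) then c else false).
split=> //; [by exists id|by exists t|].
have Hi := add_att_dart i s; have Hf := add_att_far i s.
have Hi' : add_att h' (inl e0) (~~ c) = inr i by have := add_att_dart i s'; rewrite Ei.
have Hf' : add_att h' (inl e0) c = inl (att e0 c).
  by have := add_att_far i s'; rewrite Ei -[(_, _).2]/(~~ c) negbK.
move=> x b; rewrite /t; have [->|n1] := eqVneq x (inl e0).
  have [->|nb] := eqVneq b c.
    by rewrite [RHS]Hi /= addbN addbb.
  have -> : b = ~~ c by case: (b) (c) nb => -[].
  by rewrite addbb [RHS]Hf /= Ei.
have [->|n2] := eqVneq x (inr (Some i)).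
  by case: b; [rewrite addTb; exact: Hi' | rewrite addFb; exact: Hf'].
rewrite addbF; case: x n1 n2 => [e|[j|]] //= n1 n2; last first.
  have -> : h' j = h j by case: i j n2 Eo {Ei e0 c ne0 t tK Hi Hi' Hf Hf' n1} => -[].
  by [].
have ne : e != e0 by apply: contraNneq n1 => ->.
have nh : ((e, b) == h i) = false by apply/eqP => E; rewrite /e0 -E eqxx in ne.
have nh' : ((e, b) == h' i) = false.
  by apply/eqP => E; rewrite /e0 -[(h i).1]/((h i).1, ~~ (h i).2).1 -Ei -E eqxx in ne.
by case: i nh nh' Eo {Ei e0 c ne0 t tK Hi Hi' Hf Hf' n1 n2 ne} => /= -> -> ->.
Qed.

(** The moving end walks along darts off the edge [e2] of the fixed one, either turning at a vertex
    ([slide_flink]) or reversing along an edge ([reverse_iso]). All these darts are reached because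
    the graph stays connected without [e2]. *)
Lemma add_slide h h' (i : bool) : separate h -> separate h' -> h' (~~ i) = h (~~ i) ->
  flink (add h) (add h').
Proof.
move=> s s' Eo; set e2 := (h (~~ i)).1.
pose r (d d' : fE G * bool) := (d'.1 != e2) &&
  ((att d.1 d.2 == att d'.1 d'.2) || (d' == (d.1, ~~ d.2))).
pose reach d := d.1 != e2 /\ forall k, k (~~ i) = h (~~ i) -> k i = d -> flink (add h) (add k).
have sep k : k (~~ i) = h (~~ i) -> (k i).1 != e2 -> separate k.
  by move=> Ek; rewrite /e2 -Ek /separate; case: (i) => //; rewrite eq_sym.
have reach0 : reach (h i).
  split; first exact: separateP.
  move=> k Ek Ei; apply: (@slide_flink _ _ i) => //; last by rewrite Ei.
  by apply: sep => //; rewrite Ei; exact: separateP.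
have reachS d d' : r d d' -> reach d -> reach d'.
  case/andP=> nd' rr [nd H]; split=> // k Ek Ei.
  pose k0 j := if j == i then d else h j.
  have k0o : k0 (~~ i) = h (~~ i) by rewrite /k0; case: (i).
  have k0i : k0 i = d by rewrite /k0 eqxx.
  have s0 : separate k0 by apply: sep; rewrite ?k0i.
  have sk : separate k by apply: sep; rewrite ?Ei.
  apply: flink_trans (H k0 k0o k0i) _; case/orP: rr => /eqP rr.
    by apply: (@slide_flink _ _ i) => //; [rewrite Ek k0o | rewrite Ei k0i rr].
  apply: flink_iso; first exact: add_top.
  by apply: (@reverse_iso _ _ i) => //; [rewrite Ek k0o | rewrite Ei k0i rr].
have reachC d d' : connect r d d' -> reach d -> reach d'.
  by case/connectP => p; elim: p d => [|x p IH] d /= => [_ -> //|/andP[rx px] E] /(reachS _ _ rx); exact: IH.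
suff conn : connect r (h i) (h' i).
  by have [_] := reachC _ _ conn reach0; apply.
pose W := [set v | [exists d, connect r (h i) d && (att d.1 d.2 == v)]].
have inW d d' : connect r (h i) d -> r d d' -> att d'.1 d'.2 \in W.
  move=> c1 rd; rewrite inE; apply/existsP; exists d'.
  by rewrite eqxx (connect_trans c1) ?connect1.
(* A proper [W] would have a cut of at least 3 edges, and one other than [e2] would carry the walk
   out of [W]. *)
have WT : W = setT.
  apply/eqP; apply: contraT => WT.
  have W0 : W != set0.
    apply/set0Pn; exists (att (h i).1 (h i).2); rewrite inE; apply/existsP.
    by exists (h i); rewrite connect0 eqxx.
  have [[_ /(_ W W0 WT) k3] _ _] := tG.
  have /subsetPn[e eW ne] : ~~ (bnd W \subset [set e2]).
    by apply/negP => /subset_leq_card; rewrite cards1; lia.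
  rewrite inE in ne.
  have [b bW nbW] : exists2 b, att e b \in W & att e (~~ b) \notin W.
    move: eW; rewrite inE; case E: (att e false \in W) => /=.
      by move=> H; exists false; rewrite ?E //; case: (_ \in W) H.
    by move=> H; exists true; rewrite ?E //; case: (_ \in W) H.
  move: (bW); rewrite inE => /existsP[d /andP[cd /eqP Ed]].
  have c1 : connect r (h i) (e, b).
    by apply: (connect_trans cd); apply: connect1; rewrite /r ne /= Ed eqxx.
  by move: nbW; rewrite (inW (e, b) (e, ~~ b)) // /r ne eqxx orbT.
have := in_setT (att (h' i).1 (h' i).2); rewrite -WT inE => /existsP[d /andP[cd /eqP Ed]].
apply: (connect_trans cd); apply: connect1; rewrite /r Ed eqxx andbT.
by rewrite /e2 -Eo; exact: separateP.
Qed.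

(** One end is slid after the other. If the target of the first lies on the edge of the second, the
    second is first parked on a third edge. *)
Lemma add_flink h h' : separate h -> separate h' -> flink (add h) (add h').
Proof.
move=> s s'; pose mk d1 d2 : bool -> fE G * bool := fun j => if j then d2 else d1.
have [E|ne] := eqVneq (h' false).1 (h true).1; last first.
  have sm : separate (mk (h' false) (h true)) by [].
  apply: (flink_trans (add_slide (i := false) s sm erefl)).
  exact: (add_slide (i := true) sm s').
have E3 : 2 < #|fE G| by have [[V0 _] _ c] := tG; lia.
have /subsetPn[e _] : ~~ ([set: fE G] \subset [set (h false).1; (h' false).1]).
  by apply/negP => /subset_leq_card; rewrite cardsT cards2 => /(leq_trans E3); case: (_ != _).
rewrite !inE negb_or => /andP[ne ne'].
have s1 : separate (mk (h false) (e, true)) by rewrite /separate eq_sym.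
have s2 : separate (mk (h' false) (e, true)) by rewrite /separate eq_sym.
apply: (flink_trans (add_slide (i := true) s s1 erefl)).
apply: (flink_trans (add_slide (i := false) s1 s2 erefl)).
exact: (add_slide (i := true) s2 s').
Qed.

End Slide.

Lemma add_iso (G H : fgraph) (h : bool -> fE G * bool) : separate h -> fiso G H ->
  exists h' : bool -> fE H * bool, separate h' /\ fiso (add h) (add h').
Proof.
move=> s [u [t [r [bu bt st ws]]]].
have [u' uK u'K] := bu; have [t' tK t'K] := bt.
pose h' i := (t (h i).1, (h i).2 (+) r (h i).1).
have hE e b i : ((t e, b (+) r e) == h' i) = ((e, b) == h i).
  rewrite /h' (surjective_pairing (h i)) /= !xpair_eqE (can_eq tK).
  by case: eqP => // -> /=; rewrite (can_eq (addbK _)).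
exists h'; split; first by rewrite /separate /= (can_eq tK).
pose U (x : fV G + bool) : fV H + bool := match x with inl v => inl (u v) | inr i => inr i end.
pose U' (x : fV H + bool) : fV G + bool := match x with inl v => inl (u' v) | inr i => inr i end.
pose T (x : fE G + option bool) : fE H + option bool := match x with inl v => inl (t v) | inr i => inr i end.
pose T' (x : fE H + option bool) : fE G + option bool := match x with inl v => inl (t' v) | inr i => inr i end.
exists U, T, (fun x => if x is inl e then r e else false); split=> //.
- by exists U' => -[] // x; rewrite /= ?uK ?u'K.
- by exists T' => -[] // x; rewrite /= ?tK ?t'K.
- move=> [e|[j|]] b /=; rewrite ?addbF //; last by case: b; rewrite //= st.
  by rewrite !hE st; case: ifP => // _; case: ifP.
Qed.

(** With both marked edges different from [f], the flip lifts to [inl f]; the half of a marked edge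
    next to an old vertex moves as the marked dart did. *)
Lemma add_flip (V E : finType) (a a' : E -> bool -> V) : flip a a' -> top (gr a) -> top (gr a') ->
  exists h : bool -> E * bool, separate (G := gr a) h /\ flink (add (G := gr a) h) (add (G := gr a') h).
Proof.
move=> fl tG tG'; have [f [ne ef H]] := fl.
have E3 : 2 < #|E| by have [[/= V0 _] _ /= c] := tG; lia.
have /card_gt1P[e1 [e2 [e1f e2f e12]]] : 1 < #|[set~ f]| by rewrite cardsC1; lia.
rewrite !inE in e1f e2f.
pose h i := (if i then e2 else e1, true).
have s : separate (G := gr a) h by [].
exists h; split=> //; apply: flink_flip; [exact: (@add_top (gr a)) | exact: (@add_top (gr a'))|].
have nf b i : (f, b) <> h i by case: i => -[E0]; rewrite E0 eqxx in e1f e2f.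
have af b : add_att (G := gr a) h (inl f) b = inl (a f b) by rewrite add_att_other.
have af' b : add_att (G := gr a') h (inl f) b = inl (a f b) by rewrite add_att_other //= ef.
exists (inl f); split.
- by rewrite !af => -[].
- by move=> b; rewrite af af'.
- have aux d c : a d.1 d.2 = a f c /\ a' d.1 d.2 = a f (~~ c) ->
    (inl (a d.1 d.2) : V + bool) = inl (a f c) /\ (inl (a' d.1 d.2) : V + bool) = inl (a f (~~ c)).
    by case=> -> ->.
  move=> [e|[j|]] b.
  + case: (H e b) => [E0|[c [E0 E0']]]; first by left; rewrite /add_att /= E0.
    have [/existsP[j /eqP Ej]|/existsPn nh] := boolP [exists j, (e, b) == h j].
      left; have := add_att_dart (G := gr a) j s; have := add_att_dart (G := gr a') j s.
      by rewrite -Ej => -> ->.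
    have nh' j : (e, b) <> h j by move/eqP => Ej; have := nh j; rewrite Ej.
    by right; exists c; rewrite !af !add_att_other //= E0 E0'.
  + case: b; first by left.
    case: (H (h j).1 (h j).2) => [E0|[c E0]]; first by left; rewrite /add_att /= E0.
    by right; exists c; rewrite !af; exact: aux.
  + by left.
Qed.

Lemma flink_add G H : flink G H ->
  forall (h : bool -> fE G * bool) (h' : bool -> fE H * bool), separate h -> separate h' ->
  flink (add (G := G) h) (add (G := H) h').
Proof.
elim=> {G H} [G H tG iso|V E a a' ta ta' fl|G H K GH IH1 HK IH2] h h' s s'.
- have [k [sk isok]] := add_iso s iso.
  apply: flink_trans (flink_iso _ isok) _; first exact: add_top.
  by apply: add_flink => //; exact: top_iso iso tG.
- have [k [sk lk]] := add_flip fl ta ta'.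
  apply: flink_trans (add_flink ta s sk) _; apply: flink_trans lk _.
  exact: add_flink.
- have [_ tH] := flink_top GH.
  have E3 : 1 < #|fE H| by have [[V0 _] _ c] := tH; lia.
  have /card_gt1P[e1 [e2 [_ _ e12]]] : 1 < #|[set: fE H]| by rewrite cardsT.
  pose k (i : bool) := (if i then e2 else e1, true).
  by apply: flink_trans (IH1 h k s _) (IH2 k h' _ s').
Qed.

(** * Reduction of cubic graphs *)

Lemma inj_surj_bij (T T' : finType) (f : T -> T') :
  injective f -> (forall y, exists x, f x = y) -> bijective f.
Proof.
move=> inj surj; apply: inj_card_bij => //.
rewrite -(card_codom inj); apply/subset_leq_card/subsetP => y _.
by have [x <-] := surj y; exact: codom_f.
Qed.

(** At a single vertex, 3 darts already make up a cut of 3 edges. The next lemma counts the 6 darts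
    at two vertices: two parallel edges would leave a cut of at most 2. *)
Lemma top_noloop (G : fgraph) (e : fE G) b : top G -> att e b <> att e (~~ b).
Proof.
move=> tG E; have := top_darts [set att e b] tG; rewrite cards1.
have [[V0 _] _ c] := tG; have V1 : 1 < #|fV G| by lia.
have /subsetPn[w _ wn] : ~~ ([set: fV G] \subset [set att e b]).
  by apply/negP => /subset_leq_card; rewrite cardsT cards1 leqNgt V1.
have [kG _ _] := tG; have := kconn_bnd kG (set11 (att e b)) wn.
have : 0 < #|inn [set att e b]|.
  apply/card_gt0P; exists e; rewrite !inE; case: b E {wn} => /= E; by rewrite ?E eqxx ?E.
by lia.
Qed.

Lemma top_noparallel (G : fgraph) (e e' : fE G) b b' : top G -> 2 < #|fV G| ->
  att e b = att e' b' -> att e (~~ b) = att e' (~~ b') -> e = e'.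
Proof.
move=> tG V2 E1 E2; apply/eqP; apply: contraT => ne.
pose x := att e b; pose y := att e (~~ b).
have xy : x != y by apply/eqP; exact: top_noloop.
have := top_darts [set x; y] tG; rewrite cards2 xy.
have /subsetPn[w _ wn] : ~~ ([set: fV G] \subset [set x; y]).
  by apply/negP => /subset_leq_card; rewrite cardsT cards2 xy leqNgt V2.
have [kG _ _] := tG; have := kconn_bnd kG (set21 x y) wn.
have : 1 < #|inn [set x; y]|.
  apply/card_gt1P; exists e, e'; split=> //; rewrite inE.
    by rewrite /x /y; case: (b); rewrite !inE !eqxx ?orbT.
  by rewrite /x /y E1 E2; case: (b'); rewrite !inE !eqxx ?orbT.
by lia.
Qed.

(* An edge inside an inclusion-minimal side of a 3-edge cut crosses no nontrivial 3-edge cut. *)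
Lemma removable_edge (G : fgraph) : top G -> 2 < #|fV G| ->
  exists n : fE G, forall B : {set fV G}, att n false \in B -> att n true \notin B ->
    1 < #|B| -> 1 < #|~: B| -> 3 < #|bnd B|.
Proof.
move=> tG V2; have [kG _ _] := tG.
pose P (A : {set fV G}) := [&& #|bnd A| == 3, 1 < #|A| & A != setT].
have /card_gt0P[z _] : 0 < #|fV G| by lia.
have Pz : P [set~ z].
  have zn : z \notin [set~ z] by rewrite !inE eqxx.
  have nT : [set~ z] != setT by apply: contraNneq zn => ->.
  have /card_gt0P[w wz] : 0 < #|[set~ z]| by rewrite cardsC1; lia.
  have := kconn_bnd kG wz zn; have := top_darts [set z] tG.
  rewrite /P nT cardsC1 bndC cards1.
  by move=> ? ?; apply/and3P; split=> //; [apply/eqP|]; lia.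
case: (@arg_minnP _ _ P (fun A => #|A|) Pz) => A /and3P[/eqP A3 A1 AT] minA.
have cA := top_darts A tG; rewrite A3 in cA.
(* From $3|A|=2|\mathrm{inn}(A)|+3$ and $|A|\geq 2$. *)
have /card_gt0P[n] : 0 < #|inn A| by lia.
rewrite inE => /andP[xA yA]; exists n => B xB yB B1 B1'.
rewrite ltn_neqAle (kconn_bnd kG xB yB) andbT; apply/negP => /eqP B3.
have smaller (C : {set fV G}) : C \subset A -> #|bnd C| = 3 -> 1 < #|C| ->
    forall w, w \in A -> w \notin C -> False.
  move=> sub C3 C1 w wA wC.
  have PC : P C by rewrite /P C3 C1; apply: contraNneq wC => ->.
  have := minA C PC; apply/negP; rewrite -ltnNge; apply: proper_card; apply/properP.
  by split=> //; exists w.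
have [/subsetP sBA|/subsetPn[c cB cA']] := boolP (B \subset A).
  by apply: (smaller B _ _ _ (att n true)) => //; apply/subsetP.
have [sCA|/subsetPn[d dB dA]] := boolP (~: B \subset A).
  by apply: (smaller (~: B) _ _ _ (att n false)); rewrite ?bndC // inE negbK.
rewrite inE in dB.
have I3 : 2 < #|bnd (A :&: B)|.
  by apply: (@kconn_bnd _ _ _ (att n false) (att n true)); rewrite ?inE ?xA ?xB // negb_and yB orbT.
have U3 : 2 < #|bnd (A :|: B)|.
  by apply: (@kconn_bnd _ _ _ (att n false) d); rewrite ?inE ?xA // negb_or dA.
have D3 : 2 < #|bnd (A :\: B)|.
  by apply: (@kconn_bnd _ _ _ (att n true) (att n false)); rewrite ?inE ?yA ?yB // negb_and negbK xB.
have E3 : 2 < #|bnd (B :\: A)|.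
  by apply: (@kconn_bnd _ _ _ c (att n false)); rewrite ?inE ?cB ?cA' // negb_and negbK xA.
(* All four corners have cuts of at least 3 edges, so uncrossing two 3-edge cuts gives equality.
   Minimality of [A] then leaves at most one vertex in each of [A :&: B] and [A :\: B]. *)
have [I3' D3'] : #|bnd (A :&: B)| = 3 /\ #|bnd (A :\: B)| = 3.
  move: (bnd_submod A B) (bnd_submodD A B) I3 U3 D3 E3; rewrite A3 -B3; clear; lia.
have I1 : #|A :&: B| <= 1.
  rewrite leqNgt; apply/negP => I1.
  apply: (smaller _ (subsetIl A B) _ I1 (att n true)) => //.
  by rewrite inE negb_and yB orbT.
have D1 : #|A :\: B| <= 1.
  rewrite leqNgt; apply/negP => D1.
  apply: (smaller _ (subsetDl A B) _ D1 (att n false)) => //.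
  by rewrite inE negb_and negbK xB.
(* Now $|A|=2$, against the parity of $3|A|=2|\mathrm{inn}(A)|+3$. *)
by move: cA A1 I1 D1 (cardsID B A); clear; lia.
Qed.

Section Decompose.
Variables (G : fgraph) (n : fE G).
Hypothesis tG : top G.
Hypothesis V2 : 2 < #|fV G|.
Hypothesis removable : forall B : {set fV G}, att n false \in B -> att n true \notin B ->
    1 < #|B| -> 1 < #|~: B| -> 3 < #|bnd B|.
(** The two darts besides [(n, i)] at the endpoint [i] of [n]. Deleting [n] and suppressing this
    endpoint keeps the edge of [d i], with its end moved to the far end [u i] of [d' i], and drops
    the edge of [d' i]. *)
Variables (d d' : bool -> fE G * bool).
Hypothesis dd' : forall i, d i <> d' i.
Hypothesis darts_end : forall i e b, att e b = att n i <-> [\/ (e, b) = (n, i), (e, b) = d i | (e, b) = d' i].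
Hypothesis dn : forall i, d i <> (n, i).
Hypothesis d'n : forall i, d' i <> (n, i).

Let X i := att n i.
Let u i := att (d' i).1 (~~ (d' i).2).

Let X01 : X false <> X true.
Proof. exact: top_noloop. Qed.

Let X_inj : injective X.
Proof. by case; case => // E; case: X01. Qed.

Let dX i : att (d i).1 (d i).2 = X i.
Proof. by apply/darts_end/Or32; rewrite -surjective_pairing. Qed.

Let d'X i : att (d' i).1 (d' i).2 = X i.
Proof. by apply/darts_end/Or33; rewrite -surjective_pairing. Qed.

Let edge_n i (c : fE G * bool) : att c.1 c.2 = X i -> c <> (n, i) -> c.1 <> n.
Proof.
case: c => e b /= E ne en; subst e; apply: ne; congr (_, _); exact: X_inj.
Qed.

Let far i (c : fE G * bool) : att c.1 c.2 = X i -> c <> (n, i) -> forall j, att c.1 (~~ c.2) <> X j.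
Proof.
move=> E ne j E2; have [ij|nij] := eqVneq i j.
  by subst j; apply: (@top_noloop _ c.1 c.2 tG); rewrite E E2.
apply: (edge_n E ne); apply: (top_noparallel tG V2 E).
by rewrite E2; congr (att n _); case: i j nij {E E2 ne} => -[].
Qed.

Let edge_inj i j (c c' : fE G * bool) : att c.1 c.2 = X i -> c <> (n, i) ->
  att c'.1 c'.2 = X j -> c.1 = c'.1 -> c = c'.
Proof.
move=> E ne E' Ec; case: (c) (c') E ne E' Ec => [e b] [e' b'] /= E ne E' Ec; subst e'.
congr (_, _); have [//|nb] := eqVneq b b'; case: (@far i (e, b) E ne j).
by rewrite /= -E'; congr att; case: b b' nb {E E' ne} => -[].
Qed.

Let uX i j : u i <> X j.
Proof. exact: (far (d'X i) (d'n (i := i))). Qed.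

Let d_inj i j : (d i).1 = (d j).1 -> i = j.
Proof.
move=> E; apply: X_inj; rewrite -(dX i) -(dX j).
by rewrite (edge_inj (dX i) (dn (i := i)) (dX j) E).
Qed.

Let d'_inj i j : (d' i).1 = (d' j).1 -> i = j.
Proof.
move=> E; apply: X_inj; rewrite -(d'X i) -(d'X j).
by rewrite (edge_inj (d'X i) (d'n (i := i)) (d'X j) E).
Qed.

Let dd'_edge i j : (d i).1 <> (d' j).1.
Proof.
move=> E; have Ed := edge_inj (dX i) (dn (i := i)) (d'X j) E.
have Eij : i = j by apply: X_inj; rewrite -(dX i) -(d'X j) Ed.
by subst j; exact: dd' Ed.
Qed.

Let V0 : finType := {v : fV G | [forall i, v != X i]}.
Let E0 : finType := {e : fE G | (e != n) && [forall i, e != (d' i).1]}.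

Let v0 : V0.
Proof.
by exists (u false); apply/forallP => i; apply/eqP; exact: uX.
Defined.

Let a0 (e : fE G) (b : bool) : fV G :=
  if (e, b) == d false then u false else if (e, b) == d true then u true else att e b.

Let a0P (e : E0) b : [forall i, a0 (val e) b != X i].
Proof.
rewrite /a0; apply/forallP => i; apply/eqP.
case: eqP => [_|n1]; first exact: uX.
case: eqP => [_|n2]; first exact: uX.
case/darts_end.
- by case=> E _; have /andP[/eqP/(_ E)] := valP e.
- by case: i => E; [exact: n2|exact: n1].
- by move=> E; have /andP[_ /forallP/(_ i)/eqP] := valP e; rewrite -E; case.
Qed.

Let att0 (e : E0) b : V0 := insubd v0 (a0 (val e) b).

Let val_att0 e b : val (att0 e b) = a0 (val e) b.
Proof. by rewrite /att0 insubdK //; exact: a0P. Qed.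

Let hP i : ((d i).1 != n) && [forall j, (d i).1 != (d' j).1].
Proof.
apply/andP; split; first by apply/eqP; apply: (edge_n (dX i) (dn (i := i))).
by apply/forallP => j; apply/eqP; exact: dd'_edge.
Qed.

Let h i : E0 * bool := (Sub (d i).1 (hP i), (d i).2).

Let G0 := gr att0.

Let hE (e : E0) b i : ((e, b) == h i) = ((val e, b) == d i).
Proof. by rewrite (surjective_pairing (d i)) !xpair_eqE -(inj_eq val_inj) SubK. Qed.

Let sep_h : separate (G := G0) h.
Proof.
rewrite /separate -(inj_eq val_inj) !SubK; apply/eqP => E.
by have := d_inj E.
Qed.

Let u_att0 i : val (att0 (h i).1 (h i).2) = u i.
Proof.
rewrite val_att0 /a0 /h /= -surjective_pairing.
by case: i; rewrite eqxx //; case: eqP => // E; have := d_inj (congr1 fst E).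
Qed.

Lemma decompose_iso : fiso (add (G := G0) h) G.
Proof.
pose s (x : V0 + bool) := match x with inl v => val v | inr i => X i end.
pose t (x : E0 + option bool) := match x with inl e => val e | inr None => n | inr (Some i) => (d' i).1 end.
exists s, t, (fun x => if x is inr (Some i) then ~~ (d' i).2 else false); split.
- apply: inj_surj_bij => [[v|i] [w|j] /= E|v].
  + by congr inl; exact: val_inj.
  + by have /forallP/(_ j)/eqP/(_ E) := valP v.
  + by have /forallP/(_ i)/eqP/(_ (esym E)) := valP w.
  + by congr inr; exact: X_inj.
  have [vP|/forallPn[i]] := boolP [forall i, v != X i]; first by exists (inl (Sub v vP)); rewrite /= ?SubK.
  by rewrite negbK => /eqP->; exists (inr i).
- apply: inj_surj_bij => [[e|[i|]] [e'|[j|]] /= E //|e].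
  + by congr inl; exact: val_inj.
  + by have /andP[_ /forallP/(_ j)/eqP/(_ E)] := valP e.
  + by have /andP[/eqP/(_ E)] := valP e.
  + by have /andP[_ /forallP/(_ i)/eqP/(_ (esym E))] := valP e'.
  + by congr (inr (Some _)); exact: d'_inj.
  + by case: (edge_n (d'X i) (d'n (i := i)) E).
  + by have /andP[/eqP/(_ (esym E))] := valP e'.
  + by case: (edge_n (d'X j) (d'n (i := j)) (esym E)).
  have [->|en] := eqVneq e n; first by exists (inr None).
  have [eP|/forallPn[i]] := boolP [forall i, e != (d' i).1].
    have eP' : (e != n) && [forall i, e != (d' i).1] by rewrite en.
    by exists (inl (Sub e eP')); rewrite /= ?SubK.
  by rewrite negbK => /eqP->; exists (inr (Some i)).
- move=> [e|[i|]] b; rewrite ?addbF //.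
  + rewrite /= !hE; case: eqP => [E|n1].
      by have := dX false; rewrite -E.
    case: eqP => [E|n2]; first by have := dX true; rewrite -E.
    by rewrite /= val_att0 /a0; case: eqP => //; case: eqP.
  + case: b; rewrite ?addTb ?addFb ?negbK /=; first exact: d'X.
    by rewrite u_att0.
- by move=> v; have [_ wG _] := tG; rewrite wG.
Qed.

(** A cut of [G0] lifts to [G] by putting each [X i] on the side of [u i], so that only [n] can
    cross in addition. If [n] crosses, each side contains some [X i] with its [u i], and [removable]
    gives 4 edges before [n] is discounted. *)
Lemma decompose_kconn : kconn 3 G0.
Proof.
split; first by apply/card_gt0P; exists v0.
move=> B0 /set0Pn[b0 b0B] B0T.
have /subsetPn[c0 _ c0B] : ~~ ([set: fV G0] \subset B0) by rewrite subTset.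
pose B := [set val v | v in B0].
have valB v : (val v \in B) = (v \in B0) by rewrite (mem_imset _ _ val_inj).
have XB i : X i \in B = false.
  by apply/imsetP => -[v _ E]; have /forallP/(_ i)/eqP/(_ (esym E)) := valP v.
pose A := [set v | (v \in B) || [exists i, (v == X i) && (u i \in B)]].
have XA i : (X i \in A) = (u i \in B).
  rewrite inE XB /=; apply/existsP/idP => [[j /andP[/eqP/X_inj->]]//|uB].
  by exists i; rewrite eqxx.
have VA v : (forall i, v <> X i) -> (v \in A) = (v \in B).
  move=> vX; rewrite inE; case: (v \in B) => //=.
  by apply/existsP => -[i /andP[/eqP/vX]].
have uA i : (u i \in A) = (u i \in B) by apply: VA => j; exact: uX.
have V0A (v : V0) : (val v \in A) = (v \in B0).
  by rewrite VA ?valB // => i E; have /forallP/(_ i)/eqP/(_ E) := valP v.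
have att0A e b : (att (val e) b \in A) = (att0 e b \in B0).
  rewrite -valB val_att0 /a0; case: eqP => [E|n1].
    by have := dX false; rewrite -E /= => ->; rewrite XA.
  case: eqP => [E|n2]; first by have := dX true; rewrite -E /= => ->; rewrite XA.
  rewrite VA // => i E; have /forallP/(_ i)/eqP := a0P e b; apply.
  by rewrite /a0 (introF eqP n1) (introF eqP n2).
have f_out i : (d' i).1 \notin bnd A.
  rewrite (bndE _ _ (d' i).2) d'X XA -/(u i) uA. by rewrite eqxx.
have sub : bnd A :\ n \subset [set val e | e in bnd (B0 : {set fV G0})].
  apply/subsetP => e; rewrite in_setD1 => /andP[en eA].
  have eP : (e != n) && [forall i, e != (d' i).1].
    by rewrite en; apply/forallP => i; apply: contraNneq (f_out i) => <-.
  apply/imsetP; exists (Sub e eP); last by rewrite SubK.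
  by rewrite inE /= -!att0A SubK; move: eA; rewrite inE.
apply: leq_trans (leq_imset_card val _); apply: leq_trans (subset_leq_card sub).
have bA : val b0 \in A by rewrite V0A.
have cA : val c0 \notin A by rewrite V0A.
have [kG _ _] := tG; have A3 := kconn_bnd kG bA cA.
have := cardsD1 n (bnd A); case: (boolP (n \in bnd A)) => nA cD; last by move: A3; rewrite cD add0n.
suff: 3 < #|bnd A| by rewrite cD.
have big (C : {set fV G}) i : X i \in C -> u i \in C -> 1 < #|C|.
  move=> XC uC; apply/card_gt1P; exists (X i), (u i); split=> //.
  by apply/eqP => /esym; exact: uX.
move: nA; rewrite inE -/(X false) -/(X true) => nA.
have [A0|A0] := boolP (X false \in A); move: nA; rewrite ?A0 ?(negPf A0) /=.
  case: (boolP (X true \in A)) => // nA1 _; apply: removable => //.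
    by apply: (big _ false) => //; rewrite uA -XA.
  by apply: (big _ true); rewrite inE ?uA -?XA.
case: (boolP (X true \in A)) => // A1 _; rewrite -bndC; apply: removable.
- by rewrite inE.
- by rewrite inE negbK.
- by apply: (big _ false); rewrite inE ?uA -?XA.
- by rewrite setCK; apply: (big _ true) => //; rewrite uA -XA.
Qed.

Lemma decompose_aux : exists (G1 : fgraph) (k : bool -> fE G1 * bool),
  [/\ top G1, separate k & fiso (add k) G].
Proof.
exists G0, h; split=> //; last exact: decompose_iso.
split=> //; first exact: decompose_kconn.
have [cV cE] := fiso_card decompose_iso; have [aV aE] := add_card (G := G0) h.
have [_ _] := tG; rewrite -cV -cE aV aE.
by move: #|fV G0| #|fE G0|; clear; lia.
Qed.
End Decompose.

Lemma decompose (G : fgraph) : top G -> 2 < #|fV G| ->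
  exists (G1 : fgraph) (k : bool -> fE G1 * bool),
  [/\ top G1, separate k & fiso (add k) G].
Proof.
move=> tG V2; have [n rem] := removable_edge tG V2.
have two i : exists c : (fE G * bool) * (fE G * bool), [/\ c.1 != c.2, c.1 != (n, i), c.2 != (n, i) &
    darts [set att n i] = [set (n, i); c.1; c.2]].
  have nin : (n, i) \in darts [set att n i] by rewrite !inE.
  have /eqP/cards2P[x [y [xy E]]] : #|darts [set att n i] :\ (n, i)| = 2.
    by have := cardsD1 (n, i) (darts [set att n i]); rewrite nin -/(deg _) top_deg // => -[E]; exact: (esym E).
  exists (x, y); split=> //=.
  - by have := set21 x y; rewrite -E !inE => /andP[].
  - by have := set22 x y; rewrite -E !inE => /andP[].
  - by rewrite -setUA -E setD1K.
have [c0 [c01 c02 c03 c04]] := two false; have [c1 [c11 c12 c13 c14]] := two true.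
pose d i := if i then c1.1 else c0.1; pose d' i := if i then c1.2 else c0.2.
apply: (@decompose_aux G n tG V2 rem d d').
- by case; apply/eqP.
- move=> i e b.
  have -> : att e b = att n i <-> (e, b) \in darts [set att n i].
    by rewrite !inE; split=> [->|/eqP].
  have -> : darts [set att n i] = [set (n, i); d i; d' i] by case: i; rewrite ?c14 ?c04.
  rewrite !inE -orbA; split=> [/or3P[]/eqP->|[]->]; rewrite ?eqxx ?orbT //.
  + exact: Or31.
  + exact: Or32.
  + exact: Or33.
- by case; apply/eqP.
- by case; apply/eqP.
Qed.

Lemma card_eq_bij (T T' : finType) : #|T| = #|T'| -> exists f : T -> T', bijective f.
Proof.
move=> E; exists (fun x => enum_val (cast_ord E (enum_rank x))).
exists (fun y => enum_val (cast_ord (esym E) (enum_rank y))) => x;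
  by rewrite enum_valK ?cast_ordK ?cast_ordKV enum_rankK.
Qed.

Lemma card2_eq (T : finType) (x y z : T) : #|T| = 2 -> x != z -> y != z -> x = y.
Proof.
move=> T2 xz yz; apply/eqP; apply: contraT => xy.
suff: 2 < #|T| by rewrite T2.
by apply/card_gt2P; exists x, y, z; split=> //; split=> //; rewrite eq_sym.
Qed.

(** Without loops every edge joins the two vertices, so any bijections work once the reversal bits
    are set. *)
Lemma theta_iso (G H : fgraph) : top G -> top H -> #|fV G| = 2 -> #|fV H| = 2 -> fiso G H.
Proof.
move=> tG tH VG VH.
have [s bs] : exists s : fV G -> fV H, bijective s by apply: card_eq_bij; rewrite VG.
have [t bt] : exists t : fE G -> fE H, bijective t.
  by apply: card_eq_bij; have [_ _ c] := tG; have [_ _ c'] := tH; lia.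
exists s, t, (fun e => att (t e) false != s (att e false)); split=> //; last first.
  by have [_ wG _] := tG; have [_ wH _] := tH => v; rewrite wG wH.
move=> e; have sne : s (att e true) != s (att e false).
  by rewrite (bij_eq bs); apply/eqP; exact: (@top_noloop _ e true).
have tne : att (t e) true != att (t e) false by apply/eqP; exact: (@top_noloop _ (t e) true).
have [E|ne] := eqVneq (att (t e) false) (s (att e false)).
  case=> //=; apply: (card2_eq VH) sne; by rewrite -E.
have E : att (t e) true = s (att e false).
  by apply: (card2_eq VH tne); rewrite eq_sym.
by case=> //=; apply: (card2_eq VH) sne.
Qed.

Theorem top_flink (G H : fgraph) : top G -> top H -> #|fV G| = #|fV H| -> flink G H.
Proof.
have [m] := ubnP #|fV G|; elim: m G H => // m IH G H ltm tG tH VV.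
have [V2|V2] := ltnP 2 #|fV G|; last first.
  have VG : #|fV G| = 2 by have [[V0 _] _ c] := tG; lia.
  by apply: flink_iso => //; apply: theta_iso => //; rewrite -VV.
have [G1 [k [tG1 sk iso]]] := decompose tG V2.
have [H1 [l [tH1 sl isoH]]] : exists (G1 : fgraph) (k : bool -> fE G1 * bool),
  [/\ top G1, separate k & fiso (add k) H] by apply: decompose => //; rewrite -VV.
have [cG _] := fiso_card iso; have [cH _] := fiso_card isoH.
have [aG _] := add_card k; have [aH _] := add_card l.
apply: flink_trans (flink_iso tG (fiso_sym iso)) _.
apply: flink_trans (flink_iso (add_top sl tH1) isoH).
by apply: flink_add => //; apply: IH => //; lia.
Qed.

(** * Strata and their closures *)

Definition to_f (G : wgraph) : fgraph :=
  @FGraph 'I_(nv G) 'I_(ne G) (fun e b => if b then (ends e).2 else (ends e).1) (@wt G).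

Definition of_f (G : fgraph) : wgraph :=
  @WGraph #|fV G| #|fE G|
    (fun e => (enum_rank (att (enum_val e) false), enum_rank (att (enum_val e) true)))
    (fun v => fw (enum_val v)).

Lemma of_fK (G : fgraph) : fiso G (to_f (of_f G)).
Proof.
exists enum_rank, enum_rank, (fun=> false); split=> [|||v] /=.
- by exists enum_val; [exact: enum_rankK | exact: enum_valK].
- by exists enum_val; [exact: enum_rankK | exact: enum_valK].
- by move=> e [] /=; rewrite enum_rankK.
- by rewrite enum_rankK.
Qed.

Lemma wg_iso_fiso (G H : wgraph) : wg_iso G H <-> fiso (to_f G) (to_f H).
Proof.
split=> [[s [t [bs bt st ws]]]|[s [t [r [bs bt st ws]]]]].
  exists s, t, (fun e => ends (t e) != (s (ends e).1, s (ends e).2)); split=> // e b /=.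
  case: (st e) => E; rewrite E; first by rewrite eqxx; case: b.
  by case: eqP => [[E1 E2]|_]; case: b => //=; rewrite ?E1.
exists s, t; split=> // e; have := st e false; have := st e true; rewrite /=.
by case: (r e) => /= <- <-; [right|left]; case: (ends (t e)).
Qed.

Lemma to_f_bnd (G : wgraph) (A : {set 'I_(nv G)}) e :
  (e \in @bnd (to_f G) A) = (((ends e).1 \in A) != ((ends e).2 \in A)).
Proof. by rewrite inE. Qed.

(** A set crossed only by edges of [S] is closed under adjacency; conversely the set reachable from
    [u] is crossed by no other edge. *)
Lemma connected_woP (G : wgraph) (S : {set 'I_(ne G)}) : connected_wo S <->
  0 < nv G /\ forall A : {set 'I_(nv G)}, A != set0 -> A != setT ->
    exists2 e, e \notin S & e \in @bnd (to_f G) A.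
Proof.
split=> -[V0 con]; split=> //.
  move=> A /set0Pn[u uA] AT.
  have /subsetPn[v _ vA] : ~~ ([set: 'I_(nv G)] \subset A) by rewrite subTset.
  have [/existsP[e /andP[eS eA]]|/existsPn none] :=
    boolP [exists e, (e \notin S) && (e \in @bnd (to_f G) A)]; first by exists e.
  have clA : closed (adj_wo S) (mem A).
    move=> x y /existsP[e /andP[eS E]]; have := none e; rewrite eS to_f_bnd negbK.
    by case/orP: E => /eqP-> /= /eqP.
  have E : (u \in A) = (v \in A) := closed_connect clA (con u v).
  by rewrite uA (negPf vA) in E.
move=> u v; pose A := [set w | connect (adj_wo S) u w].
have [AT|AT] := eqVneq A setT; first by have := in_setT v; rewrite -AT inE.
have A0 : A != set0 by apply/set0Pn; exists u; rewrite inE connect0.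
have [e eS] := con A A0 AT; rewrite to_f_bnd !inE.
have adj : adj_wo S (ends e).1 (ends e).2 /\ adj_wo S (ends e).2 (ends e).1.
  by split; apply/existsP; exists e; rewrite eS -surjective_pairing eqxx ?orbT.
have [c1|c1] := boolP (connect _ u (ends e).1).
  by rewrite (connect_trans c1 (connect1 adj.1)).
have [c2|//] := boolP (connect _ u (ends e).2).
by rewrite (connect_trans c2 (connect1 adj.2)) in c1.
Qed.

Lemma three_edge_connectedP (G : wgraph) : three_edge_connected G <-> kconn 3 (to_f G).
Proof.
split=> -[V0 H]; split; rewrite ?card_ord // in V0 *.
  move=> A A0 AT; rewrite leqNgt; apply/negP => lt3.
  by have /connected_woP[_ /(_ A A0 AT)[e /negP]] := H _ lt3.
move=> S S3; apply/connected_woP; split=> // A A0 AT.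
have := H A A0 AT; case: (boolP (@bnd (to_f G) A \subset S)) => [/subset_leq_card|/subsetPn[e eA eS] _].
  by move=> le1 le2; have := leq_trans (leq_trans le2 le1) S3; rewrite ltnn.
by exists e.
Qed.

Lemma to_f_deg (G : wgraph) (v : 'I_(nv G)) : @deg (to_f G) v = valency v.
Proof.
rewrite /deg /valency cards_sum (eq_bigl predT) //.
rewrite -(pair_bigA _ (fun e b => (@att (to_f G) e b \in [set v] : nat))) /=.
under eq_bigr do rewrite big_bool /= !inE.
by rewrite big_split /= addnC -!cards_sum.
Qed.

Lemma to_f_genus (G : wgraph) : fgenus (to_f G) = genus G.
Proof. by rewrite /fgenus /genus /= !card_ord. Qed.

Lemma wg3_okP pure g (G : wgraph) : 2 <= g -> wg3_ok pure g G <-> fok pure g (to_f G).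
Proof.
move=> g2; split=> [[[con st gG pG] /three_edge_connectedP k3]|ok].
  by split=> //; [rewrite to_f_genus | case: pure pG].
have [k3 gG pG] := ok; have c3 : three_edge_connected G by apply/three_edge_connectedP.
split=> //; split=> //.
- by case: c3 => _; apply; rewrite cards0.
- by move=> v wv; rewrite -to_f_deg; apply: fok_stable ok wv.
- by rewrite -to_f_genus.
- by case: pure pG {ok} => // /(_ isT).
Qed.

(** * Connectedness of the unit interval *)

Section Topology.
Variable R : realType.
Implicit Type C : tcurve R.
Local Open Scope ring_scope.

(** Let [s] be the supremum of the points where [P] holds. If [P s], then [P] holds slightly to the
    right of [s]; if [Q s], then [Q] holds at points of [P] close to [s]. *)
Lemma interval_connected (P Q : R -> Prop) :
  P 0 -> Q 1 ->
  (forall t, 0 <= t <= 1 -> P t \/ Q t) ->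
  (forall t, 0 <= t <= 1 -> P t -> Q t -> False) ->
  (forall t, 0 <= t <= 1 -> P t -> exists2 d, 0 < d &
     forall u, 0 <= u <= 1 -> `|u - t| < d -> P u) ->
  (forall t, 0 <= t <= 1 -> Q t -> exists2 d, 0 < d &
     forall u, 0 <= u <= 1 -> `|u - t| < d -> Q u) -> False.
Proof.
move=> P0 Q1 PQ disj Po Qo.
pose E := (fun t => 0 <= t <= 1 /\ P t) : classical_sets.set R.
have supE : classical_sets.has_sup E.
  split; first by exists 0; split=> //; rewrite lexx ler01.
  by exists 1 => t [/andP[]].
set s := sup E.
have s01 : 0 <= s <= 1.
  apply/andP; split.
    by apply: sup_upper_bound => //; split=> //; rewrite lexx ler01.
  by apply: ge_sup; [case: supE | move=> t [/andP[]]].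
case: (PQ s s01) => [Ps|Qs].
  have [d d0 dP] := Po s s01 Ps.
  have s1 : s < 1.
    rewrite lt_neqAle; case/andP: (s01) => _ ->; rewrite andbT; apply/eqP => E1.
    by apply: (disj 1); rewrite ?lexx ?ler01 -?E1 //; rewrite E1.
  pose u := Num.min 1 (s + d / 2).
  have su : s < u by rewrite /u lt_min s1 /=; lra.
  have u01 : 0 <= u <= 1 by rewrite /u ge_min lexx /= le_min; lra.
  have : u <= s.
    apply: sup_upper_bound => //; split=> //; apply: dP => //.
    rewrite gtr0_norm; last by lra.
    have : u <= s + d / 2 by rewrite /u ge_min lexx orbT.
    by lra.
  by lra.
have [d d0 dQ] := Qo s s01 Qs.
have [t [t01 Pt] ts] := sup_adherent d0 supE.
apply: (disj t) => //; apply: dQ => //.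
have : t <= s by apply: sup_upper_bound.
by move=> ?; rewrite ltr_norml; rewrite -/s in ts; lra.
Qed.

End Topology.

(** * Connectedness and closures of strata *)

Section Topology.
Variable R : realType.
Implicit Type C : tcurve R.
Local Open Scope ring_scope.

Definition fstratum (F : fgraph) C : Prop :=
  fiso F (to_f (cg C)) /\ forall e : 'I_(ne (cg C)), 0 < len e.

Lemma stratumE (G : wgraph) C : stratum G C <-> fstratum (to_f G) C.
Proof. by rewrite /stratum /fstratum; split=> -[/wg_iso_fiso]. Qed.

Lemma fstratum_iso F F' C : fiso F F' -> fstratum F C -> fstratum F' C.
Proof. by move=> iso [iC lC]; split=> //; exact: fiso_trans (fiso_sym iso) iC. Qed.

Lemma stratum_of_f F C : stratum (of_f F) C <-> fstratum F C.
Proof.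
rewrite stratumE; split; apply: fstratum_iso; last exact: of_fK.
exact: fiso_sym (of_fK F).
Qed.

Lemma fstratum_isM3 pure g F C : (2 <= g)%N -> fok pure g F -> fstratum F C -> isM3 pure g C.
Proof.
move=> g2 okF [iC lC]; have /(wg3_okP _ _ g2)[okC c3] := fok_iso iC okF.
by [].
Qed.

Lemma isM3_fstratum C pure g : isM3 pure g C -> fstratum (to_f (cg C)) C.
Proof. by case=> -[_ lC] _; split=> //; exact: fiso_refl. Qed.

Lemma isM3_fok pure g C : (2 <= g)%N -> isM3 pure g C -> fok pure g (to_f (cg C)).
Proof. by move=> g2 [[okC _] c3]; apply/wg3_okP. Qed.

Lemma isM_false pure g C : isM pure g C -> isM false g C.
Proof. by case=> -[]. Qed.

Lemma contr_pos (G : wgraph) (l : 'I_(ne G) -> R) C :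
  (forall e, 0 < l e) -> contr l C -> curve_iso (TCurve l) C.
Proof.
move=> l0; rewrite /contr.
have -> : [set e | l e == 0] = set0 by apply/setP => e; rewrite !inE gt_eqF.
case=> pi [iota [surj [inj [cover [ker [endsE [wE lenE]]]]]]].
have noadj x y : adj_wo (~: (@set0 'I_(ne G))) x y = false.
  by apply/existsP => -[e]; rewrite !inE.
have pi_inj : injective pi.
  move=> u v /ker/connectP[[|x p] /=]; first by move=> _ ->.
  by rewrite noadj.
have inv e : exists e', iota e' == e.
  by have /cover[e' <-] : e \notin set0; [rewrite inE | exists e'].
pose t e := xchoose (inv e).
have tK e : iota (t e) = e by apply/eqP; exact: xchooseP (inv e).
have fib v : #|[set u | pi u == pi v]| = 1%N.
  by rewrite (_ : [set u | _] = [set v]) ?cards1 //; apply/setP => u; rewrite !inE (inj_eq pi_inj).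
exists pi, t; split=> /=.
- by apply: inj_surj_bij.
- exists iota => e; first exact: tK.
  by apply: inj; rewrite tK.
- by move=> e; left; rewrite endsE tK.
- move=> v; rewrite wE fib (eq_bigl (pred1 v)); last by move=> u; rewrite (inj_eq pi_inj).
  rewrite big_pred1_eq (_ : [set _ in _ | _] = set0) ?cards0 //.
  by apply/setP => e; rewrite !inE.
- by move=> e; rewrite lenE tK.
Qed.

Lemma pos_contr (G : wgraph) (l : 'I_(ne G) -> R) :
  (forall e, 0 < l e) -> contr l (TCurve l).
Proof.
move=> l0; rewrite /contr /=.
have -> : [set e | l e == 0] = set0 by apply/setP => e; rewrite !inE gt_eqF.
exists id, id; split; first by move=> v; exists v.
split=> //; split; first by move=> e; rewrite inE; split=> // _; exists e.
split.
  move=> u v; split=> [->|/connectP[[|x p] /=]]; first exact: connect0.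
    by move=> _ ->.
  by case/andP => /existsP[e]; rewrite !inE.
split; first by move=> e; case: (ends e).
split=> // v; rewrite big_pred1_eq (_ : [set e in set0 | _] = set0) ?cards0.
  by rewrite (_ : [set u | _] = [set v]) ?cards1 //; apply/setP => u; rewrite !inE.
by apply/setP => e; rewrite !inE.
Qed.

Lemma curve_iso_fiso C C' : curve_iso C C' -> fiso (to_f (cg C)) (to_f (cg C')).
Proof.
by case=> s [t [bs bt st ws _]]; apply/wg_iso_fiso; exists s, t.
Qed.

Lemma curve_iso_fstratum F C C' : curve_iso C C' -> fstratum F C -> fstratum F C'.
Proof.
move=> iso [iC lC]; split; first exact: fiso_trans iC (curve_iso_fiso iso).
case: iso => s [t [_ [t' tK t'K] _ _ lE]] e.
by rewrite -(t'K e) lE.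
Qed.

Section Fixed.
Variables (pure : bool) (g : nat).
Hypothesis g2 : (2 <= g)%N.
Let X := isM3 (R := R) pure g.
Let open := qopen g X (@curve_iso R).

(** For positive lengths [contr] collapses nothing and determines the curve up to isomorphism, under
    which [U] is invariant. *)
Lemma open_nbhd O (G : wgraph) (l : 'I_(ne G) -> R) : open O -> fok pure g (to_f G) ->
  (forall e, 0 < l e) -> O (TCurve l) ->
  exists2 eps, 0 < eps & forall l' : 'I_(ne G) -> R, (forall e, 0 < l' e) ->
    (forall e, `|l' e - l e| < eps) -> O (TCurve l').
Proof.
move=> [OX _ [U [[Uiso Uo] OU]]] ok l0 Ol.
have okf : wg_ok false g G by have /(wg3_okP _ _ g2)[[? ? ? _] _] := ok.
have XG (k : 'I_(ne G) -> R) : (forall e, 0 < k e) -> X (TCurve k).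
  by move=> k0; apply: fstratum_isM3 ok _ => //; split=> //; exact: fiso_refl.
have [||eps e0 H] := Uo G okf l; first by move=> e; exact: ltW.
  by exists (TCurve l); split; [exact: pos_contr | apply/OU => //; exact: XG].
exists eps => // l' l'0 close; apply/OU; first exact: XG.
have [|C' [con UC']] := H l' _ close; first by move=> e; exact: ltW.
have iso := contr_pos l'0 con.
have XC' : X C'.
  apply: fstratum_isM3 ok _ => //; apply: curve_iso_fstratum iso _.
  by split=> //; exact: fiso_refl.
have [s [t [[s' sK s'K] [t' tK t'K] st ws lE]]] := iso.
apply: Uiso UC'; [exact: isM_false XC'.1 | exact: isM_false (XG _ l'0).1|].
exists s', t'; split.
- by exists s.
- by exists t.
- move=> e; have := st (t' e); rewrite t'K /= => -[]->; [left|right];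
    by rewrite /= !sK; case: (ends (t' e)).
- by move=> v; rewrite -[in RHS](s'K v) ws.
- by move=> e; rewrite -[in RHS](t'K e) lE.
Qed.

(** The lengths of [C'] are pulled back to the graph of [C]; the segment [L] between the two length
    vectors stays in the open cone, and [interval_connected] applies along it. *)
Lemma fstratum_connected F O1 O2 C C' : fok pure g F -> open O1 -> open O2 ->
  (forall D, fstratum F D -> O1 D \/ O2 D) ->
  (forall D, fstratum F D -> O1 D -> O2 D -> False) ->
  fstratum F C -> fstratum F C' -> O1 C -> O1 C'.
Proof.
move=> okF o1 o2 cov disj FC FC' O1C.
have okC : fok pure g (to_f (cg C)) by apply: fok_iso okF; case: FC.
have /wg_iso_fiso[s [t [bs bt st ws]]] : fiso (to_f (cg C)) (to_f (cg C')).
  by case: FC FC' => iC _ [iC' _]; exact: fiso_trans (fiso_sym iC) iC'.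
pose l1 e := len (t e).
have isoC' : curve_iso (TCurve l1) C' by exists s, t.
have l0p (e : 'I_(ne (cg C))) : 0 < len e by case: FC => _ lC; exact: lC.
have l1p e : 0 < l1 e by case: FC' => _ lC'; exact: (lC' (t e)).
pose L (x : R) e := len e + x * (l1 e - len e).
have Lp x e : 0 <= x <= 1 -> 0 < L x e.
  case/andP => x0 x1; rewrite /L.
  have := l0p e; have := l1p e; move: (len e) (l1 e) => a b b0 a0.
  have -> : a + x * (b - a) = (1 - x) * a + x * b by lra.
  have [->|xn] := eqVneq x 0; first by lra.
  have xp : 0 < x by rewrite lt_neqAle eq_sym xn.
  have : 0 < x * b by exact: mulr_gt0.
  have : 0 <= (1 - x) * a by apply: mulr_ge0; [lra|exact: ltW].
  by lra.
have LF x : 0 <= x <= 1 -> fstratum F (TCurve (L x)).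
  by move=> x01; split; [case: FC | move=> e; exact: Lp].
have XF D : fstratum F D -> X D by exact: fstratum_isM3.
have L1 : fstratum F (TCurve l1) by split; [case: FC|].
have O1L0 : O1 (TCurve (L 0)).
  case: (o1) => _ sat _; apply: (sat C) => //; [exact: XF|by apply/XF/LF; rewrite lexx ler01|].
  exists id, id; split=> //; try by exists id.
    by move=> e; left; case: (ends e).
  by move=> e; rewrite /= /L mul0r addr0.
suff: O1 (TCurve l1) by case: (o1) => _ sat _; apply: (sat _ _ (XF _ L1) (XF _ FC') isoC').
case: (cov _ L1) => // O2L1; exfalso.
have O2L : O2 (TCurve (L 1)).
  case: (o2) => _ sat _; apply: sat O2L1; [exact: XF|by apply/XF/LF; rewrite lexx ler01|].
  exists id, id; split=> //; try by exists id.
    by move=> e; left; case: (ends e).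
  by move=> e; rewrite /= /L mul1r addrC subrK.
(* A bound for the speed of every coordinate of [L]; the summand 1 makes it positive even on a
   constant segment. *)
pose M := 1 + \sum_e `|l1 e - len e|.
have M0 : 0 < M by rewrite ltr_pwDl // sumr_ge0.
have near O : open O -> forall x, 0 <= x <= 1 -> O (TCurve (L x)) ->
    exists2 d, 0 < d & forall y, 0 <= y <= 1 -> `|y - x| < d -> O (TCurve (L y)).
  move=> oO x x01 Ox.
  have [eps e0 H] := open_nbhd oO okC (fun e => Lp x e x01) Ox.
  exists (eps / M); first exact: divr_gt0.
  move=> y y01 yx; apply: H => [e|e]; first exact: Lp.
  rewrite /L (_ : _ - _ = (y - x) * (l1 e - len e)); last by lra.
  rewrite normrM; apply: (@le_lt_trans _ _ (`|y - x| * M)).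
    apply: ler_wpM2l => //; rewrite /M (bigD1 e) //=.
    by rewrite addrCA lerDl addr_ge0 // sumr_ge0.
  by rewrite -ltr_pdivlMr.
apply: (@interval_connected R (fun x => O1 (TCurve (L x))) (fun x => O2 (TCurve (L x)))) => //.
- by move=> x x01; apply: cov; exact: LF.
- by move=> x x01; apply: disj; exact: LF.
- exact: near.
- exact: near.
Qed.

(** Extending the lengths of [C] by 0 on the contracted edge [f] gives a point of the closed cone of
    [F']. Openness there lets [f] grow to a positive length. *)
Lemma closure_contr F' F C : fok pure g F' -> fok pure g F -> fcontr F' F -> fstratum F C ->
  in_qclosure g X (@curve_iso R) (fstratum F') C.
Proof.
move=> okF' okF con FC O oO OC; have [OX sat [U [[Uiso Uo] OU]]] := oO.
have [G' isoF'] : exists G', fiso F' (to_f G') by exists (of_f F'); exact: of_fK.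
have okG' : fok pure g (to_f G') := fok_iso isoF' okF'.
have okG'f : wg_ok false g G' by have /(wg3_okP _ _ g2)[[? ? ? _] _] := okG'.
have [iC lC] := FC.
have := fcontr_iso_l isoF' (fcontr_iso_r con iC) => -[f pi iota r surj inj cover ker pi_att wpi].
(* [contr] asks for oriented ends, whereas [fcontr] allows reversals; so the edges of [C] are
   reoriented to match [G']. *)
pose G1 := @WGraph (nv (cg C)) (ne (cg C))
  (fun e => (pi (ends (iota e)).1, pi (ends (iota e)).2)) (@wt (cg C)).
pose C1 := @TCurve R G1 (@len R C).
have iso1 : curve_iso C C1.
  exists id, id; split=> //; try by exists id.
  move=> e; have := pi_att e false; have := pi_att e true; rewrite /=.
  by case: (r e) => /= -> ->; [right|left].
pose l e := if [pick e' | iota e' == e] is Some e' then len e' else 0 : R.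
have l_iota e' : l (iota e') = len e'.
  by rewrite /l; case: pickP => [x /eqP/inj->|/(_ e')] //; rewrite eqxx.
have lf : l f = 0.
  rewrite /l; case: pickP => // x /eqP E.
  by have /cover : exists e', iota e' = f by exists x.
have l_pos e : e != f -> 0 < l e.
  by move/eqP/cover => [e' <-]; rewrite l_iota.
have l_ge0 e : 0 <= l e.
  by have [->|/l_pos/ltW//] := eqVneq e f; rewrite lf.
have con1 : contr l C1.
  rewrite /contr; have -> : [set e | l e == 0] = [set f].
    by apply/setP => e; rewrite !inE; have [->|/l_pos/gt_eqF->//] := eqVneq e f; rewrite lf eqxx.
  exists pi, iota; split=> //; split=> //; split.
    by move=> e; rewrite -cover inE; split=> [/eqP|/eqP].
  split.
    have adj x y : adj_wo (~: [set f]) x y <-> (ends f = (x, y) \/ ends f = (y, x)).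
      split=> [/existsP[e]|H].
        rewrite !inE negbK => /andP[/eqP->] /orP[]/eqP; by [left|right].
      apply/existsP; exists f; rewrite in_setC negbK in_set1 eqxx /=.
      by apply/orP; case: H => E; [left|right]; apply/eqP.
    move=> u v; split.
      case/ker => [->|[b [-> ->]]]; first exact: connect0.
      apply: connect1; apply/adj; rewrite /=.
      by case: b => /=; case: (ends f); [right|left].
    case/connectP => p; elim: p u => [|x p IH] u /=; first by move=> _ ->.
    case/andP => /adj ux px E; rewrite -(IH x px E); apply/ker; right.
    by case: ux => E1; [exists false|exists true]; rewrite /= E1.
  split=> //; split=> // v; rewrite [LHS](wpi v); congr (_ + _ - _ + _)%N.
  have [E|E] := eqVneq (pi (ends f).1) v.
    rewrite (_ : [set e in _ | _] = [set f]) ?cards1 //=; try by rewrite ?E ?eqxx.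
    by apply/setP => e; rewrite !inE; have [->|//] := eqVneq e f; rewrite ?E ?eqxx.
  rewrite (_ : [set e in _ | _] = set0) ?cards0 //=; try by rewrite (negPf E).
  by apply/setP => e; rewrite !inE; have [->|//] := eqVneq e f; rewrite (negPf E).
have XC : X C := OX _ OC.
have XC1 : X C1 by apply: (fstratum_isM3 g2 okF); exact: curve_iso_fstratum iso1 FC.
have UC1 : U C1.
  apply: (Uiso C C1 _ _ iso1); [exact: isM_false XC.1|exact: isM_false XC1.1|exact/OU].
have [eps e0 H] := Uo G' okG'f l l_ge0 (ex_intro _ C1 (conj con1 UC1)).
pose l' e := if e == f then eps / 2 else l e.
have l'p e : 0 < l' e by rewrite /l'; case: eqVneq => [_|/l_pos//]; lra.
have [||C2 [con2 UC2]] := H l'; first by move=> e; exact: ltW.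
  move=> e; rewrite /l'; case: eqVneq => [->|_]; last by rewrite subrr normr0.
  by rewrite lf subr0 gtr0_norm; lra.
have FC2 : fstratum F' C2.
  by apply: (curve_iso_fstratum (contr_pos l'p con2)); exact: (conj isoF' l'p).
by exists C2; split=> //; apply/OU => //; exact: fstratum_isM3 FC2.
Qed.

Lemma closure_expands F T C : fok pure g F -> fexpands pure g F T -> fstratum F C ->
  in_qclosure g X (@curve_iso R) (fstratum T) C.
Proof.
move=> okF ex; elim: ex okF C => {F T} [F|F F1 F2 ok1 _ con _ IH] okF C FC O oO OC.
  by exists C.
have [C' [FC' OC']] := closure_contr ok1 okF con FC oO OC.
exact: (IH ok1 C' FC' O oO OC').
Qed.

End Fixed.
End Topology.

(** * Separations, and passage to the Schottky locus *)

Lemma flink_fgenus G H : flink G H -> fgenus G = fgenus H.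
Proof.
elim=> {G H} [G H _ /fgenus_iso//|V E a a' _ _ _|G H K _ -> _ ->] //.
Qed.

Section Assembly.
Variables (R : realType) (pure : bool) (g : nat).
Hypothesis g2 : 2 <= g.
Let X := isM3 (R := R) pure g.
Let open := qopen g X (@curve_iso R).

Lemma fstratum_inhabited F : exists C : tcurve R, fstratum F C.
Proof. by exists (TCurve (cg := of_f F) (fun=> 1%R)); split=> //; exact: of_fK. Qed.

Section Sides.
Variables O1 O2 : tcurve R -> Prop.
Hypotheses (o1 : open O1) (o2 : open O2).

(** Graphs of the strata of codimension at most one. *)
Definition thick (F : fgraph) := fok pure g F /\ 3 * g - 3 - 1 <= #|fE F|.

Hypothesis cover : forall F C, thick F -> fstratum F C -> O1 C \/ O2 C.
Hypothesis disj : forall F C, thick F -> fstratum F C -> O1 C -> O2 C -> False.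

Let side (O : tcurve R -> Prop) F := forall C, fstratum F C -> O C.

Let side_some1 F C : thick F -> fstratum F C -> O1 C -> side O1 F.
Proof.
move=> tF FC OC D FD; have [okF _] := tF.
by apply: (fstratum_connected g2 okF o1 o2 _ _ FC FD OC) => E; [exact: cover|exact: disj].
Qed.

Let side_up1 F' F : thick F' -> thick F -> fcontr F' F -> side O1 F -> side O1 F'.
Proof.
move=> tF' tF con sF; have [C FC] := fstratum_inhabited F.
have [C' [FC' OC']] := closure_contr g2 tF'.1 tF.1 con FC o1 (sF _ FC).
exact: side_some1 FC' OC'.
Qed.

(** Otherwise [O2] contains a point of the stratum of [F], hence meets that of [F'], which lies in
    [O1]. *)
Let side_down1 F' F : thick F' -> thick F -> fcontr F' F -> side O1 F' -> side O1 F.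
Proof.
move=> tF' tF con sF'; have [C FC] := fstratum_inhabited F.
case: (cover tF FC) => [|O2C]; first exact: side_some1.
have [C' [FC' OC']] := closure_contr g2 tF'.1 tF.1 con FC o2 O2C.
by case: (disj tF' FC' (sF' _ FC') OC').
Qed.

Let top_thick F : top F -> fgenus F = g -> thick F.
Proof.
move=> tF gF; have [_ cE] := top_card tF gF g2; split; last by rewrite cE leq_subr.
by case: tF => kF wF _; split.
Qed.

(** Across a flip the side passes down to the common contraction and up again. *)
Let side_flink F F' : flink F F' -> fgenus F = g -> side O1 F -> side O1 F'.
Proof.
elim=> {F F'} [F F' _ iso _ sF C FC|V E a a' ta ta' fl gF sa|F F' F'' FF' IH1 _ IH2 gF sF].
- by apply: sF; apply: fstratum_iso FC; exact: fiso_sym.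
- have tha := top_thick ta gF; have tha' := top_thick ta' gF.
  have [H [okH cH con con']] := flip_common pure fl ta.
  have [_ /= cE] := top_card ta gF g2.
  have tH : thick H.
    split; last by rewrite -cE -cH subn1.
    by case: okH => kH gH pH; split=> //; rewrite gH -gF /fgenus /= big1 // addn0.
  exact: (side_up1 tha' tH con' (side_down1 tha tH con sa)).
- by apply: IH2; [rewrite -(flink_fgenus FF') | exact: IH1].
Qed.

Let side_expands F T : fexpands pure g F T -> thick F -> (side O1 F <-> side O1 T).
Proof.
elim=> {F T} // F F1 F2 ok1 c1 con _ IH tF.
have t1 : thick F1 by split=> //; rewrite c1; apply: leq_trans tF.2 _.
rewrite -IH //; split; [exact: side_up1|exact: side_down1].
Qed.

Lemma no_separation F1 F2 C1 C2 : thick F1 -> thick F2 ->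
  fstratum F1 C1 -> O1 C1 -> fstratum F2 C2 -> O2 C2 -> False.
Proof.
move=> t1 t2 FC1 OC1 FC2 OC2.
have [T1 [okT1 tT1 ex1]] := expand_to_top g2 t1.1.
have [T2 [okT2 tT2 ex2]] := expand_to_top g2 t2.1.
have [gT1 gT2] : fgenus T1 = g /\ fgenus T2 = g by case: okT1 okT2 => _ ? _ [].
have [V1 _] := top_card tT1 gT1 g2; have [V2 _] := top_card tT2 gT2 g2.
have lk : flink T1 T2 by apply: top_flink => //; rewrite V1 V2.
have s1 := (side_expands ex1 t1).1 (side_some1 t1 FC1 OC1).
have s2 := (side_expands ex2 t2).2 (side_flink lk gT1 s1).
exact: (disj t2 FC2 (s2 _ FC2) OC2).
Qed.
End Sides.

Lemma thick_codim1 (C : tcurve R) F : fstratum F C -> thick F ->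
  isM3 pure g C /\ 3 * g - 3 - 1 <= ne (cg C).
Proof.
move=> FC [okF cF]; split; first exact: fstratum_isM3 FC.
by case: FC => iso _; have [_] := fiso_card iso; rewrite /= card_ord => <-.
Qed.

Lemma codim1_thick (C : tcurve R) : isM3 pure g C -> 3 * g - 3 - 1 <= ne (cg C) ->
  thick (to_f (cg C)) /\ fstratum (to_f (cg C)) C.
Proof.
move=> MC cC; split; last exact: isM3_fstratum MC.
by split; [exact: isM3_fok | rewrite /= card_ord].
Qed.

Lemma M3_connected : M3_conn_codim1 R pure g (3 * g - 3).
Proof.
move=> [O1 [O2 [o1 o2 cov dis [[C1 [[M1 c1] OC1]] [C2 [[M2 c2] OC2]]]]]].
have [t1 F1] := codim1_thick M1 c1; have [t2 F2] := codim1_thick M2 c2.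
apply: (no_separation o1 o2 _ _ t1 t2 F1 OC1 F2 OC2) => F C tF FC.
  by apply: cov; exact: thick_codim1 tF.
by apply: dis; exact: thick_codim1 tF.
Qed.

Lemma M3_expands_top (G : wgraph) : wg3_ok pure g G ->
  ne G <= 3 * g - 3 /\ exists T : fgraph, [/\ fok pure g T, #|fE T| = 3 * g - 3 &
    forall C : tcurve R, stratum G C -> in_qclosure g X (@curve_iso R) (fstratum T) C].
Proof.
move=> /(wg3_okP _ _ g2) ok; split; first by have := fok_edges g2 ok; rewrite /= card_ord.
have [T [okT tT ex]] := expand_to_top g2 ok; exists T; split=> //.
  by have [_ gT _] := okT; have [_] := top_card tT gT g2.
by move=> C /stratumE; exact: closure_expands ex.
Qed.

Lemma M3_dim : M3_pure_dim R pure g (3 * g - 3).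
Proof.
move=> G /M3_expands_top[cG [T [okT cT clos]]]; split=> //; exists (of_f T); split=> //.
  by apply/(wg3_okP _ _ g2); exact: fok_iso (of_fK T) okT.
move=> C GC O oO OC; have [C' [TC' OC']] := clos C GC O oO OC.
by exists C'; split=> //; apply/stratum_of_f.
Qed.

Lemma torelli_refl (C : tcurve R) : torelli_eq C C.
Proof. by exists id; split=> // x Lx; exists x. Qed.

(** Saturation under isomorphism comes from the invariance of the open set [U] whose trace is
    [O]. *)
Lemma torelli_open O : qopen g (isM (R := R) pure g) (@torelli_eq R) O ->
  open (fun C => O C /\ X C).
Proof.
move=> [OX _ [U [Uo OU]]]; split=> [C []//|C C' XC XC' iso [OC _]|].
  split=> //; apply/OU; first exact: XC'.1.
  have [Uiso _] := Uo; apply: (Uiso C C' _ _ iso).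
  - exact: isM_false XC.1.
  - exact: isM_false XC'.1.
  - by apply/OU => //; exact: XC.1.
exists U; split=> // C XC; rewrite -OU; last exact: XC.1.
by split=> [[]|].
Qed.

Lemma Sch_connected : Sch_conn_codim1 R pure g (3 * g - 3).
Proof.
move=> [O1 [O2 [o1 o2 cov dis]]].
move=> [[C1 [[M1 [C1' [N1 c1 e1]]] OC1]] [C2 [[M2 [C2' [N2 c2 e2]]] OC2]]].
have inS (C : tcurve R) : isM3 pure g C /\ 3 * g - 3 - 1 <= ne (cg C) -> isM pure g C /\
    exists C', [/\ isM3 pure g C', 3 * g - 3 - 1 <= ne (cg C') & torelli_eq C C'].
  by case=> XC cC; split; [exact: XC.1 | exists C; split=> //; exact: torelli_refl].
apply: M3_connected; exists (fun C => O1 C /\ X C), (fun C => O2 C /\ X C); split.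
- exact: torelli_open.
- exact: torelli_open.
- move=> C SC; have XC := SC.1.
  by case: (cov C (inS C SC)) => OC; [left|right].
- by move=> C SC [OC _] [OC' _]; exact: dis (inS C SC) OC OC'.
(* The two given points may lie outside [isM3]; saturation under [torelli_eq] replaces them by their
   representatives there. *)
- case: (o1) (o2) => _ sat1 _ [_ sat2 _]; split.
    by exists C1'; split=> //; split=> //; exact: (sat1 _ _ M1 N1.1 e1).
  by exists C2'; split=> //; split=> //; exact: (sat2 _ _ M2 N2.1 e2).
Qed.

Lemma Sch_dim : Sch_pure_dim R pure g (3 * g - 3).
Proof.
move=> G ok3; have [cG [T [okT cT clos]]] := M3_expands_top ok3.
split=> //; exists (of_f T); split=> //.
  by apply/(wg3_okP _ _ g2); exact: fok_iso (of_fK T) okT.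
move=> C [MC [C' [GC' tor]]] O oO OC.
have XC' : X C'.
  by move/stratumE: GC'; apply: fstratum_isM3 => //; exact/(wg3_okP _ _ g2).
have OC' : O C' by case: oO => _ sat _; exact: (sat _ _ MC XC'.1 tor).
have [C2 [TC2 [OC2 XC2]]] := clos C' GC' _ (torelli_open oO) (conj OC' XC').
exists C2; split=> //; split; first exact: XC2.1.
by exists C2; split; [exact/stratum_of_f | exact: torelli_refl].
Qed.

End Assembly.

Theorem mainTheorem13 (R : realType) (g : nat) (hg : (2 <= g)%N) :
  forall pure : bool,
    [/\ M3_pure_dim R pure g (3 * g - 3),
        M3_conn_codim1 R pure g (3 * g - 3),
        Sch_pure_dim R pure g (3 * g - 3) &
        Sch_conn_codim1 R pure g (3 * g - 3)].
Proof.
move=> pure; split.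
- exact: M3_dim.
- exact: M3_connected.
- exact: Sch_dim.
- exact: Sch_connected.
Qed.
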